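(* Let $p,q\ge 1$ be integers and define $$ Q_{[q]}^{p/q}:=\big[Q_{[q]}^{1/q}\big]^p. $$ Then $Q_{[q]}^{p/q}$ is block banded, and for every $\underline{u}\in\mathbf{P}_{[q]}$ and $-1<x\le1$, $$ {}_{-1}\mathcal{Q}_x^{p/q}\,\mathbf{P}_{[q]}(x)\underline{u}=\mathbf{P}_{[q]}(x)\,Q_{[q]}^{p/q}\,\underline{u}. $$
   Context: For $\nu>0$ the left-sided fractional integral is ${}_{-1}\mathcal{Q}_x^{\nu}f(x)=\frac{1}{\Gamma(\nu)}\int_{-1}^x\frac{f(t)}{(x-t)^{1-\nu}}\,dt$. $P_n^{(\alpha,\beta)}$ denotes the classical Jacobi polynomial (with $P_{-1}^{(\alpha,\beta)}=0$). An element $\underline{u}\in\mathbf{P}_{[q]}$ is a tuple $\underline{u}=(\underline{u}^{[0]},\dots,\underline{u}^{[q-1]})$ of coefficient sequences $\underline{u}^{[k]}=(u^{[k]}_n)_{n\ge0}$ of complex numbers, and $$\mathbf{P}_{[q]}(x)\underline{u}=\sum_{k=0}^{q-1}(1+x)^{k/q}\sum_{n=0}^\infty u_n^{[k]}P_n^{(1-k/q,\,k/q)}(x).$$ Standing convention: the sequences satisfy $\sum_{n\ge0}|u^{[k]}_n|\sup_{-1\le x\le1}|P_n^{(1-k/q,\,k/q)}(x)|<\infty$ for each $k$, so that the expansion defines a continuous function. For $\mu>0$ and $\beta\ge0$, $Q^{\mu}_{\beta}$ is the infinite diagonal matrix with $n$-th diagonal entry $\frac{\Gamma(\beta+n+1)}{\Gamma(\beta+\mu+n+1)}$,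 $n=0,1,2,\dots$. $R_{0,0}$ is the infinite matrix whose $n$-th column has entries $1$ in rows $n$ and $n+1$ and zeros elsewhere (induced by $(1+x)P_n^{(0,1)}=P_{n+1}^{(0,0)}+P_n^{(0,0)}$). $S_{0,0}$ is the infinite matrix whose $n$-th column has entry $\frac{n+1}{2n+1}$ in row $n$, entry $-\frac{n}{2n+1}$ in row $n-1$ (if $n\ge1$), and zeros elsewhere (induced by $(2n+1)P_n^{(0,0)}=(n+1)P_n^{(1,0)}-nP_{n-1}^{(1,0)}$). $Q_{[q]}^{1/q}$ is the $q\times q$ block matrix (blocks indexed by $j,k=0,\dots,q-1$, each an infinite matrix) whose block $(k+1,k)$ equals $Q^{1/q}_{k/q}$ for $k=0,\dots,q-2$, whose block $(0,q-1)$ equals $S_{0,0}R_{0,0}Q^{1/q}_{1-1/q}$, and whose other blocks are zero. ''Block banded'' means that each of the $q\times q$ blocks is a banded infinite matrix (there is $m$ such that entry $(i,j)$ of the block vanishes whenever $|i-j|>m$). *)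

(* Defs.v *)
From HB Require Import structures.
From mathcomp Require Import all_boot all_order all_algebra.
From mathcomp Require Import all_classical all_reals all_analysis.
From mathcomp Require Import complex.

Set Implicit Arguments.
Unset Strict Implicit.
Unset Printing Implicit Defensive.

Import Order.TTheory GRing.Theory Num.Theory.
Import numFieldNormedType.Exports.

Local Open Scope classical_set_scope.
Local Open Scope ring_scope.
Local Open Scope complex_scope.

(* Euler's integral; only meaningful for a > 0. *)
Definition Gamma (R : realType) (a : R) : R :=
  \int[lebesgue_measure]_(t in `]0, +oo[) (t `^ (a - 1) * expR (- t)).

(* Binomial coefficient with real upper argument, a(a-1)...(a-k+1) / k!. *)
Definition gbinom (R : realType) (a : R) (k : nat) : R :=
  (\prod_(i < k) (a - i%:R)) / k`!%:R.

(* Classical Jacobi polynomial P_n^(a, b), normalised by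
   P_n^(a, b)(1) = binom(n + a, n), in Szego's form (4.3.2):
     sum_s binom(n+a, n-s) binom(n+b, s) ((x-1)/2)^s ((x+1)/2)^(n-s). *)
Definition jacobi (R : realType) (a b : R) (n : nat) : {poly R} :=
  \sum_(s < n.+1)
     (gbinom (n%:R + a) (n - s) * gbinom (n%:R + b) s) *:
     ((2^-1 *: ('X - 1)) ^+ s * (2^-1 *: ('X + 1)) ^+ (n - s)).

(* Integrals of complex-valued functions are taken componentwise. *)
Definition cintegrable (R : realType) (D : set R) (f : R -> R[i]) : Prop :=
  lebesgue_measure.-integrable D (EFin \o (fun t => complex.Re (f t))) /\
  lebesgue_measure.-integrable D (EFin \o (fun t => complex.Im (f t))).

Definition cintegral (R : realType) (D : set R) (f : R -> R[i]) : R[i] :=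
  (\int[lebesgue_measure]_(t in D) complex.Re (f t)) +i*
  (\int[lebesgue_measure]_(t in D) complex.Im (f t)).

Definition frac_integrand (R : realType) (nu : R) (f : R -> R[i]) (x t : R)
    : R[i] :=
  f t / ((x - t) `^ (1 - nu))%:C.

Definition frac_integrable (R : realType) (nu : R) (f : R -> R[i]) (x : R)
    : Prop :=
  cintegrable `]-1, x[ (frac_integrand nu f x).

Definition frac_integral (R : realType) (nu : R) (f : R -> R[i]) (x : R)
    : R[i] :=
  ((Gamma nu)^-1)%:C * cintegral `]-1, x[ (frac_integrand nu f x).

Definition infmx (R : realType) := nat -> nat -> R.

Definition infmx_mul (R : realType) (A B : infmx R) : infmx R :=
  fun i j => limn (series (fun l => A i l * B l j)).

(* R[i]^o is R[i] with the topology of its norm. *)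
Definition infmx_act (R : realType) (A : infmx R) (u : nat -> R[i])
    : nat -> R[i] :=
  fun i => limn (series (fun j => (A i j)%:C * u j : R[i]^o)).

Definition banded (R : realType) (A : infmx R) : Prop :=
  exists m : nat, forall i j : nat,
    ((i + m < j) || (j + m < i))%N -> A i j = 0.

Definition diagQ (R : realType) (mu beta : R) : infmx R :=
  fun i j =>
    if i == j then Gamma (beta + i%:R + 1) / Gamma (beta + mu + i%:R + 1)
    else 0.

Definition mxR00 (R : realType) : infmx R :=
  fun i n => if (i == n) || (i == n.+1) then 1 else 0.

Definition mxS00 (R : realType) : infmx R :=
  fun i n =>
    if i == n then n.+1%:R / (2 * n + 1)%:R
    else if i.+1 == n then - (n%:R / (2 * n + 1)%:R)
    else 0.

Definition blockmx (R : realType) (q : nat) := 'M[infmx R]_q.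

Definition blockmx_one (R : realType) (q : nat) : blockmx R q :=
  \matrix_(j, k) (fun m n : nat => ((j == k) && (m == n))%:R : R).

Definition blockmx_mul (R : realType) (q : nat) (A B : blockmx R q)
    : blockmx R q :=
  \matrix_(j, k)
    (fun m n : nat => \sum_(l < q) infmx_mul (A j l) (B l k) m n).

Definition blockmx_exp (R : realType) (q : nat) (A : blockmx R q) (p : nat)
    : blockmx R q :=
  iter p (blockmx_mul A) (blockmx_one R q).

Definition blockmx_act (R : realType) (q : nat) (A : blockmx R q)
    (u : 'I_q -> nat -> R[i]) : 'I_q -> nat -> R[i] :=
  fun j n => \sum_(k < q) infmx_act (A j k) (u k) n.

Definition block_banded (R : realType) (q : nat) (A : blockmx R q) : Prop :=
  forall j k : 'I_q, banded (A j k).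

(* For q = 1 the only block is the corner one. *)
Definition Qroot (R : realType) (q : nat) : blockmx R q :=
  \matrix_(j, k)
    if (j == k.+1 :> nat) then diagQ (q%:R^-1) (k%:R / q%:R)
    else if (j == 0%N :> nat) && (k.+1 == q :> nat) then
      infmx_mul (infmx_mul (mxS00 R) (mxR00 R)) (diagQ (q%:R^-1) (1 - q%:R^-1))
    else (fun _ _ => 0).

Definition Qfrac (R : realType) (p q : nat) : blockmx R q :=
  blockmx_exp (Qroot R q) p.

(* P_n^(1 - k/q, k/q) *)
Definition basisP (R : realType) (q k n : nat) : {poly R} :=
  jacobi (1 - k%:R / q%:R) (k%:R / q%:R) n.

Definition in_Pq (R : realType) (q : nat) (u : 'I_q -> nat -> R[i]) : Prop :=
  forall k : 'I_q,
    cvgn (series (fun n : nat =>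
      ComplexField.Normc.normc (u k n) *
      sup [set `|(basisP R q k n).[x]| | x in `[-1, 1]])).

Definition evalPq (R : realType) (q : nat) (x : R) (u : 'I_q -> nat -> R[i])
    : R[i] :=
  \sum_(k < q)
    ((1 + x) `^ (k%:R / q%:R))%:C *
    limn (series (fun n : nat => u k n * ((basisP R q k n).[x])%:C : R[i]^o)).

(* Main.v *)
Require Import Defs.
From mathcomp Require Import all_boot all_order all_algebra.
From mathcomp Require Import all_classical all_reals all_analysis.
From mathcomp Require Import measurable_realfun complex ring lra zify.
Set Implicit Arguments.
Unset Strict Implicit.
Unset Printing Implicit Defensive.
Import Order.TTheory GRing.Theory Num.Theory.
Import numFieldNormedType.Exports.
Local Open Scope classical_set_scope.
Local Open Scope ring_scope.

(** The left-sided fractional integral acts on powers of [1 + x] by Euler's Beta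
    integral,
      [I^nu (1 + x)^g = Gamma (g + 1) / Gamma (g + nu + 1) * (1 + x)^(g + nu)].
    When [a + b = 1], the coefficient of [(1 + x)^j] in [P_n^(a, b)] is, up to a
    sign and a power of two, [gbinom (n + b) (n - j)] times a number that does not
    depend on [b]. Multiplied by [Gamma (b + j + 1)] the binomial becomes
    [Gamma (b + n + 1) / (n - j)!], so [I^m] maps [(1 + x)^b P_n^(1 - b, b)] to a
    multiple of [(1 + x)^(b + m) P_n^(1 - b - m, b + m)], the factor being a ratio
    of Gammas that does not involve [j] ([frac_poly_jac]). With [m = 1/q] this
    moves block [k] to block [k + 1]. From the last block the exponent becomes
    [1], and the factor [1 + x] is absorbed into the polynomial by
    [(1 + x) P_n^(0, 1) = P_(n+1) + P_n] ([mulX_jac1]) followed by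
    [(2n + 1) P_n = (n + 1) P_n^(1, 0) - n P_(n-1)^(1, 0)] ([leg_jac0]).

    For series, the semigroup law of fractional integration is needed on monomials
    only. For every [nu > 0], dominated convergence gives [I^nu] of the
    expansion term by term ([Rintegral_jac_series]). The resulting series
    [frac_series nu] also makes sense for [nu = 0], where it is the expansion
    itself, and satisfies [frac_series (nu + 1/q) v = frac_series nu (Q v)] for the
    root matrix [Q] ([frac_series_root_act]); [p] such steps lead from [I^(p/q)]
    to an evaluation. In the corner block the step rearranges a series: this is a
    summation by parts whose boundary term tends to [0]
    ([actS00R00_series]).

    It remains to see that [Q] preserves the class of admissible sequences, which
    compares sup norms of different Jacobi polynomials. Fractional integration
    provides the comparison without any asymptotics: from
    [|I^m f| <= |f|_oo I^m 1], the norm of [P_n^(1 - b - m, b + m)] times the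
    diagonal factor is at most a constant times the norm of [P_n^(1 - b, b)]
    ([gratio_jac_norm]). For the corner block one needs
    [|P_n^(1, 0)| <= n + 1], a consequence of [|P_n| <= 1] for Legendre polynomials
    ([leg_le1]), and the value of [P_n^(1/q, 1 - 1/q)] at [-1], which bounds its
    norm from below ([gratio_corner]).

    The matrices are real, so the argument is carried out on real sequences and
    applied to real and imaginary parts. Polynomials are written in the variable
    [y = 1 + x] throughout. *)

(** * Affine changes of variable *)

Section affine_change_of_variable.
Context {R : realType}.
Local Notation mu := (@lebesgue_measure R).

Let affine (r c t : R) : measurableTypeR R := r * t + c.

Let measurable_affine r c : measurable_fun [set: measurableTypeR R] (affine r c).
Proof. by apply: measurable_funD => //; exact: measurable_funM. Qed.

Lemma lebesgue_measure_affine (r c : R) (r0 : 0 < r) (A : set R) : measurable A ->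
  mu A = (r%:E * pushforward mu (affine r c) A)%E.
Proof.
move=> mA.
pose nu : {measure set (measurableTypeR R) -> \bar R} :=
  mscale (NngNum (ltW r0)) (pushforward mu (affine r c)).
rewrite (@lebesgue_measure_unique R (nu (measurable_affine r c)))//.
move=> _ [[a b]] _ <-.
rewrite /nu /= /mscale /= /pushforward.
have -> : (affine r c @^-1` `]a, b]%classic) = `](a - c) / r, (b - c) / r]%classic.
  apply/seteqP; split => t; rewrite /affine /= !in_itv/= => /andP[h1 h2].
    by rewrite ltr_pdivrMr// ler_pdivlMr//; apply/andP; split; lra.
  move: h1 h2; rewrite ltr_pdivrMr// ler_pdivlMr// => h1 h2.
  by apply/andP; split; lra.
rewrite !lebesgue_measure_itv/= !lte_fin ltr_pM2r ?invr_gt0// ltrD2r.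
case: ifP => ab; last by rewrite mule0.
rewrite -!EFinD -EFinM; congr EFin.
by rewrite -mulrBl mulrCA divff ?gt_eqF// mulr1; ring.
Qed.

(** Stated for arbitrary nonnegative measurable functions, because the integrands
    below are unbounded at the end points of their support. *)
Lemma ge0_integral_affine (f : R -> \bar R) (r c : R) : 0 < r ->
  measurable_fun setT f -> (forall t, (0 <= f t)%E) ->
  (\int[mu]_t f t = r%:E * \int[mu]_t f (r * t + c)%R)%E.
Proof.
move=> r0 mf f0.
pose nu : {measure set (measurableTypeR R) -> \bar R} :=
  mscale (NngNum (ltW r0)) (pushforward mu (affine r c)).
rewrite (@eq_measure_integral _ _ _ _ (nu (measurable_affine r c)))//; last first.
  by move=> A mA _; exact: lebesgue_measure_affine.
rewrite ge0_integral_mscale//=; congr (_ * _)%E.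
by rewrite ge0_integral_pushforward.
Qed.

End affine_change_of_variable.

(** * The Gamma function and the Beta integral *)

Section gamma.
Context {R : realType}.
Local Notation mu := (@lebesgue_measure R).

(** The power [t^(a - 1)] extended by zero to the negative axis: Gamma and Beta
    integrals become integrals over the whole line, on which Tonelli's theorem and
    affine changes of variable apply without any bookkeeping of domains. *)
Definition pospow (a t : R) : R := if 0 < t then t `^ (a - 1) else 0.

Lemma pospow_ge0 a t : 0 <= pospow a t.
Proof. by rewrite /pospow; case: ifP => // _; exact: powR_ge0. Qed.

Lemma pospow_gt0E a t : 0 < t -> pospow a t = t `^ (a - 1).
Proof. by rewrite /pospow => ->. Qed.

Lemma pospow_le0 a t : t <= 0 -> pospow a t = 0.
Proof. by rewrite /pospow ltNge => ->. Qed.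

Lemma measurable_pospow a : measurable_fun setT (pospow a).
Proof.
rewrite /pospow; apply: measurable_fun_if => //.
- exact: measurable_fun_ltr.
- by apply: measurable_funTS; exact: measurable_powR.
Qed.

Lemma pospowM a t s : 0 < t -> pospow a (t * s) = t `^ (a - 1) * pospow a s.
Proof.
move=> t0; rewrite /pospow pmulr_rgt0//; case: ifP => s0; last by rewrite mulr0.
by rewrite powRM// ltW.
Qed.

(** Extended-real version of [Gamma]; its finiteness is a consequence of the
    identities that it satisfies. *)
Definition egamma (a : R) : \bar R := \int[mu]_t (pospow a t * expR (- t))%:E.
Definition ebeta (a b : R) : \bar R :=
  \int[mu]_t (pospow a t * pospow b (1 - t))%:E.

Lemma egamma_ge0 a : (0 <= egamma a)%E.
Proof. by apply: integral_ge0 => t _; rewrite lee_fin mulr_ge0// ?pospow_ge0//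
expR_ge0. Qed.

Lemma ebeta_ge0 a b : (0 <= ebeta a b)%E.
Proof. by apply: integral_ge0 => t _; rewrite lee_fin mulr_ge0// ?pospow_ge0. Qed.

Lemma measurable_beta_integrand a b c :
  measurable_fun setT (fun t : R => (pospow a t * pospow b (c - t))%:E).
Proof.
apply/measurable_EFinP; apply: measurable_funM; first exact: measurable_pospow.
by apply: measurableT_comp; [exact: measurable_pospow|exact: measurable_funB].
Qed.

Lemma measurable_gamma_integrand a c :
  measurable_fun setT (fun t : R => (pospow a (t - c) * expR (- t))%:E).
Proof.
apply/measurable_EFinP; apply: measurable_funM.
  by apply: measurableT_comp; [exact: measurable_pospow|exact: measurable_funB].
by apply: measurableT_comp => //; exact: measurableT_comp.
Qed.

(** The convolution of two truncated powers is a truncated power, by the scaling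
    [t = x s]. *)
Lemma ebeta_scale (a b x : R) :
  (\int[mu]_t (pospow a t * pospow b (x - t))%:E =
   (pospow (a + b) x)%:E * ebeta a b)%E.
Proof.
have [x0|x0] := leP x 0.
  rewrite pospow_le0// mul0e; apply: integral0_eq => t _; congr EFin.
  have [t0|t0] := leP t 0; first by rewrite pospow_le0 ?mul0r.
  by rewrite [X in _ * X]pospow_le0 ?mulr0//; lra.
rewrite (ge0_integral_affine 0 x0 (measurable_beta_integrand a b x)); last first.
  by move=> t; rewrite lee_fin mulr_ge0// pospow_ge0.
rewrite /ebeta (pospow_gt0E _ x0).
transitivity (x%:E * ((x `^ (a - 1) * x `^ (b - 1))%:E * ebeta a b))%E.
  congr (_ * _)%E; rewrite /ebeta -ge0_integralZl//.
  - apply: eq_integral => t _; rewrite -EFinM; congr EFin.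
    rewrite addr0 pospowM// (_ : x - x * t = x * (1 - t)); last by ring.
    by rewrite pospowM//; ring.
  - exact: measurable_beta_integrand.
  - by move=> t _; rewrite lee_fin mulr_ge0// pospow_ge0.
  - by rewrite lee_fin mulr_ge0// powR_ge0.
rewrite muleA -EFinM; congr ((_)%:E * _)%E.
have xn : x != 0 by rewrite gt_eqF.
rewrite -powRD; last by rewrite xn implybT.
rewrite -{1}(powRr1 (ltW x0)) -powRD; last by rewrite xn implybT.
by congr (_ `^ _); ring.
Qed.

(** Both sides are the double integral of
    [s^(a - 1) (r - s)^(b - 1) e^(- r)] over [0 < s < r], computed in the two
    possible orders. *)
Lemma egammaM (a b : R) : (egamma a * egamma b = ebeta a b * egamma (a + b))%E.
Proof.
pose F (z : R * R) : R := pospow a z.1 * pospow b (z.2 - z.1) * expR (- z.2).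
have mF : measurable_fun setT (EFin \o F).
  apply/measurable_EFinP; apply: measurable_funM; first apply: measurable_funM.
  - by apply: measurableT_comp; [exact: measurable_pospow|].
  - by apply: measurableT_comp; [exact: measurable_pospow|exact: measurable_funB].
  - by do 2 apply: measurableT_comp => //.
have F0 z : (0 <= (EFin \o F) z)%E.
  by rewrite lee_fin !mulr_ge0 ?pospow_ge0 ?expR_ge0.
have mg c : measurable_fun setT (fun t : R => (pospow c t * expR (- t))%:E).
  by have := measurable_gamma_integrand c 0; under eq_fun do rewrite subr0.
transitivity (\int[mu]_s \int[mu]_r (F (s, r))%:E)%E; last first.
  rewrite (@fubini_tonelli _ _ _ _ _ mu mu (EFin \o F))//=.
  rewrite /egamma -ge0_integralZl//; last 3 first.
    - exact: mg.
    - by move=> t _; rewrite lee_fin mulr_ge0 ?pospow_ge0 ?expR_ge0.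
    - exact: ebeta_ge0.
  apply: eq_integral => r _.
  under eq_integral do rewrite /F/= mulrC EFinM.
  rewrite ge0_integralZl//; last 2 first.
    - exact: measurable_beta_integrand.
    - by move=> t _; rewrite lee_fin mulr_ge0 ?pospow_ge0.
  by rewrite ebeta_scale muleA -EFinM muleC mulrC.
rewrite muleC /egamma -ge0_integralZl//; last 3 first.
  - exact: mg.
  - by move=> t _; rewrite lee_fin mulr_ge0 ?pospow_ge0 ?expR_ge0.
  - exact: egamma_ge0.
apply: eq_integral => s _.
transitivity ((pospow a s * expR (- s))%:E * egamma b)%E; first by rewrite muleC.
under [RHS]eq_integral do rewrite /F/= -mulrA EFinM.
rewrite ge0_integralZl; last 4 first.
  - by [].
  - exact: measurable_gamma_integrand.
  - by move=> t _; rewrite lee_fin mulr_ge0 ?pospow_ge0 ?expR_ge0.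
  - by rewrite lee_fin pospow_ge0.
rewrite EFinM -muleA; congr (_ * _)%E.
rewrite (ge0_integral_affine s ltr01 (measurable_gamma_integrand b s)); last first.
  by move=> t; rewrite lee_fin mulr_ge0 ?pospow_ge0 ?expR_ge0.
rewrite mul1e /egamma -ge0_integralZl//; last 2 first.
  - exact: mg.
  - by move=> t _; rewrite lee_fin mulr_ge0 ?pospow_ge0 ?expR_ge0.
apply: eq_integral => t _; rewrite -EFinM; congr EFin.
by rewrite mul1r addrK opprD expRD; ring.
Qed.

Lemma cvg_powR_harmonic (a : R) : 0 < a -> (n.+2%:R^-1 : R) `^ a @[n --> \oo] -->
  (0 : R).
Proof.
move=> a0.
have : (fun n => n.+2%:R^-1 : R) @ \oo --> (0 : R)^'+.
  move=> A [e /= e0 HA].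
  have /cvgrPdist_lt /(_ _ e0) [N _ HN] := @cvg_harmonic R.
  exists N => // n /= Nn; apply: HA => //=.
  exact: (HN n.+1 (leqW Nn)).
move=> h; exact: (cvg_comp _ _ h (powR_cvg0 a0)).
Qed.

Lemma integral_powR_itv (a e : R) : 0 < a -> 0 < e < 1 ->
  (\int[mu]_(t in `[e, 1%R]) (t `^ (a - 1))%:E = (a^-1 - a^-1 * e `^ a)%:E)%E.
Proof.
move=> a0 /andP[e0 e1].
have an : a != 0 by rewrite gt_eqF.
have dp (b t : R) : 0 < t -> derivable (fun u : R => u `^ b) t 1.
  by move=> t0; apply: derivable_powR; rewrite in_itv/= t0.
have cp (b t : R) : 0 < t -> {for t, continuous (fun u : R => u `^ b)}.
  move=> t0; apply: differentiable_continuous; apply/derivable1_diffP; exact: dp.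
rewrite (@continuous_FTC2 _ _ (fun t => a^-1 * t `^ a)).
- by rewrite powR1 mulr1 EFinB.
- exact: e1.
- apply: continuous_in_subspaceT => t; rewrite inE/= in_itv/= => /andP[t0 _].
  by apply: cp; lra.
- split.
  + move=> t; rewrite in_itv/= => /andP[t0 _]; apply: derivableM => //.
    by apply: dp; lra.
  + apply: cvg_at_right_filter; apply: cvgM; first exact: cvg_cst.
    exact: cp.
  + apply: cvg_at_left_filter; apply: cvgM; first exact: cvg_cst.
    exact: cp.
- move=> t; rewrite in_itv/= => /andP[t0 _].
  have t1 : 0 < t by lra.
  rewrite derive1E deriveM//; last exact: dp.
  rewrite derive_cst scaler0 addr0 -derive1E powR_derive1 ?in_itv/= ?t1//.
  by rewrite /GRing.scale/= mulrA mulVf// mul1r.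
Qed.

(** The integrand is singular at [0] when [a < 1], so the fundamental theorem of
    calculus is applied between [1 / (n + 2)] and [1] before letting [n] tend to
    infinity. *)
Lemma ebeta_r1 (a : R) : 0 < a -> ebeta a 1 = (a^-1)%:E.
Proof.
move=> a0.
pose E n : set R := `[n.+2%:R^-1, 1]%classic.
have E01 : \bigcup_n E n = `]0, 1]%classic.
  apply/seteqP; split => [t [n _]|t].
    rewrite /E /= !in_itv/= => /andP[+ ->]; rewrite andbT.
    by apply: lt_le_trans; rewrite invr_gt0.
  rewrite /= in_itv/= => /andP[t0 t1].
  have /cvgrPdist_lt /(_ _ t0) [N _ /(_ N.+1 (leqnSn N))] := @cvg_harmonic R.
  rewrite sub0r normrN/= ger0_norm ?invr_ge0// => /ltW h; exists N => //.
  by rewrite /E/= in_itv/= h.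
have mE n : measurable (E n) by exact: measurable_itv.
pose f (t : R) := (t `^ (a - 1))%:E.
have mf (D : set R) : measurable_fun D f.
  by apply: measurable_funTS; apply/measurable_EFinP; exact: measurable_powR.
have f0 t : (0 <= f t)%E by rewrite lee_fin powR_ge0.
have ndE : nondecreasing_seq E.
  move=> m n mn; rewrite subsetEset => t; rewrite /E/= !in_itv/= => /andP[h ->].
  by rewrite andbT; apply: le_trans h; rewrite lef_pV2 ?posrE ?ler_nat.
have -> : ebeta a 1 = (\int[mu]_(t in \bigcup_n E n) f t)%E.
  rewrite E01 -integral_itv_bndo_bndc// integral_mkcond.
  apply: eq_integral => t _; rewrite patchE /f.
  case: ifPn; rewrite ?inE ?notin_setE /= in_itv/=.
    move=> /andP[t0 t1]; rewrite !pospow_gt0E//; last by lra.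
    by rewrite subrr powRr0 mulr1.
  move=> /negP; rewrite negb_and -!leNgt => /orP[t0|t1].
    by rewrite pospow_le0// mul0r.
  by rewrite [X in _ * X]pospow_le0 ?mulr0//; lra.
have h1 := ge0_nondecreasing_set_cvg_integral (mu := mu) ndE mE
  (fun i => mf (E i)) (fun i t _ => f0 t).
have h2 : (fun n => \int[mu]_(t in E n) f t)%E @ \oo --> (a^-1)%:E.
  under eq_fun => n.
    rewrite integral_powR_itv//; last first.
      by rewrite invr_gt0 ltr0n /= invf_lt1// ltr1n.
    over.
  apply: cvg_EFin; first by near=> n.
  rewrite -[X in _ --> X]subr0; apply: cvgB; first exact: cvg_cst.
  rewrite -(mulr0 a^-1); apply: cvgM; first exact: cvg_cst.
  exact: cvg_powR_harmonic.
exact: (cvg_unique _ h1 h2).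
Unshelve. all: by end_near. Qed.

Lemma egammaE (a : R) :
  egamma a = (\int[mu]_(t in `]0%R, +oo[) (t `^ (a - 1) * expR (- t))%:E)%E.
Proof.
rewrite [RHS]integral_mkcond; apply: eq_integral => t _; rewrite patchE.
case: ifPn; rewrite ?inE ?notin_setE /= in_itv/= andbT.
  by move=> t0; rewrite pospow_gt0E.
by move=> /negP; rewrite -leNgt => t0; rewrite pospow_le0// mul0r.
Qed.

Lemma egamma1 : egamma (1 : R) = 1%E.
Proof.
rewrite -(integral_exponential_pdf (ltr01 : 0 < 1 :> R)) egammaE.
under eq_integral do rewrite subrr powRr0 mul1r.
rewrite integral_itv_obnd_cbnd; last first.
  by apply/measurable_EFinP/measurable_funTS; exact: measurableT_comp.
rewrite integral_mkcond; apply: eq_integral => t _.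
rewrite /exponential_pdf !patchE; case: ifP => // _.
by rewrite mul1r mulN1r.
Qed.

(** This is [egammaM] for [b = 1], which replaces an integration by parts. *)
Lemma egammaS (a : R) : 0 < a -> egamma a = (a^-1%:E * egamma (a + 1))%E.
Proof. by move=> a0; rewrite -ebeta_r1// -egammaM egamma1 mule1. Qed.

(** The integrand is dominated by [t^(a - 1)] below [1] and by [e^(- t)] above. *)
Lemma egamma_lt_pinfty_small (a : R) : 0 < a <= 1 -> (egamma a < +oo)%E.
Proof.
move=> /andP[a0 a1].
have m1 : measurable_fun setT (fun t : R => (pospow a t * pospow 1 (1 - t))%:E).
  exact: measurable_beta_integrand.
have m2 c : measurable_fun setT (fun t : R => (pospow c t * expR (- t))%:E).
  by have := measurable_gamma_integrand c 0; under eq_fun do rewrite subr0.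
have n2 c t : (0 <= (pospow c t * expR (- t) : R)%:E)%E.
  by rewrite lee_fin mulr_ge0 ?pospow_ge0 ?expR_ge0.
have n1 t : (0 <= (pospow a t * pospow 1 (1 - t) : R)%:E)%E.
  by rewrite lee_fin mulr_ge0 ?pospow_ge0.
apply: (@le_lt_trans _ _ (ebeta a 1 + egamma 1)%E); last first.
  by rewrite ebeta_r1// egamma1 -EFinD ltry.
rewrite /ebeta /egamma -ge0_integralD//; last exact: m2.
apply: ge0_le_integral => //.
- exact: m2.
- exact: (emeasurable_funD m1 (m2 1)).
move=> t _; rewrite -EFinD lee_fin.
have [t0|t0] := leP t 0; first by rewrite !(pospow_le0 _ t0) !mul0r addr0.
rewrite !(pospow_gt0E _ t0) subrr powRr0 mul1r.
have [t1|t1] := ltP t 1.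
  rewrite pospow_gt0E ?subr_gt0// subrr powRr0 mulr1.
  rewrite -[X in X <= _]addr0 lerD ?expR_ge0//.
  by rewrite ler_piMr ?powR_ge0// -expR0 ler_expR; lra.
rewrite [pospow _ _]pospow_le0 ?mulr0 ?add0r; last by lra.
rewrite ler_piMl ?expR_ge0// -[leRHS](powRr0 t).
by apply: ler_powR => //; lra.
Qed.

Lemma egamma_lt_pinfty (a : R) : 0 < a -> (egamma a < +oo)%E.
Proof.
move=> a0.
suff H n : forall b : R, 0 < b <= n.+1%:R -> (egamma b < +oo)%E.
  have /archi_boundP := ltW a0; set m := Num.bound a => am.
  apply: (H m); rewrite a0 /=; apply/ltW/(lt_trans am); by rewrite ltr_nat.
elim: n => [b|n IH b /andP[b0 bn]]; first exact: egamma_lt_pinfty_small.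
have [b1|b1] := leP b 1; first by apply: egamma_lt_pinfty_small; rewrite b0.
have b10 : 0 < b - 1 by lra.
have := egammaS b10; rewrite subrK => h.
have -> : egamma b = ((b - 1)%:E * egamma (b - 1)%R)%E.
  by rewrite h muleA -EFinM divff ?gt_eqF// mul1e.
rewrite lte_mul_pinfty ?lee_fin ?ltW//.
apply: IH; rewrite b10 /= lerBlDr natr1 //.
Qed.

(** The integrand is bounded below by a positive constant between [1] and [2]. *)
Lemma egamma_gt0 (a : R) : (0 < egamma a)%E.
Proof.
(* [t^(a - 1)] is monotone, so it is least at [1] or at [2]. *)
pose c : R := Num.min 1 (2 `^ (a - 1)) * expR (- 2).
have c0 : 0 < c.
  by rewrite mulr_gt0 ?expR_gt0// lt_min ltr01 powR_gt0.
apply: (@lt_le_trans _ _ (\int[mu]_(t in `[1%R, 2%R]) c%:E)%E).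
  rewrite integral_cst//= lebesgue_measure_itv/= lte_fin ifT ?ltr1n//.
  by rewrite -EFinB -EFinM lte_fin mulr_gt0//; lra.
rewrite integral_mkcond; apply: ge0_le_integral => //.
- by move=> t _; apply: erestrict_ge0 => ? _; rewrite lee_fin ltW.
- by apply/(measurable_restrictT _ _).1.
- by have := measurable_gamma_integrand a 0; under eq_fun do rewrite subr0.
move=> t _; rewrite patchE; case: ifPn; last first.
  by rewrite lee_fin mulr_ge0 ?pospow_ge0 ?expR_ge0.
rewrite inE/= in_itv/= => /andP[t1 t2]; rewrite lee_fin /c ler_pM ?expR_ge0//.
- rewrite pospow_gt0E; last by lra.
  have [a1|a1] := leP 1 a; rewrite ge_min; apply/orP.
    by left; rewrite -[leLHS](powRr0 t) ler_powR// subr_ge0.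
  right; have t0 : 0 < t by lra.
  rewrite -(opprB 1 a) !(powRN _ (1 - a)) lef_pV2 ?posrE ?powR_gt0//.
  by apply: ge0_ler_powR; rewrite ?nnegrE; lra.
- by rewrite ler_expR; lra.
Qed.

Lemma egamma_fin (a : R) : 0 < a -> egamma a = (Gamma a)%:E.
Proof.
move=> a0; rewrite /Gamma /Rintegral fineK; first by rewrite egammaE.
by rewrite ge0_fin_numE -?egammaE ?egamma_ge0// egamma_lt_pinfty.
Qed.

Local Opaque Gamma egamma.

Lemma Gamma_gt0 (a : R) : 0 < a -> 0 < Gamma a.
Proof. by move=> a0; rewrite -lte_fin -egamma_fin// egamma_gt0. Qed.

Lemma GammaS (a : R) : 0 < a -> Gamma (a + 1) = a * Gamma a.
Proof.
move=> a0; apply: EFin_inj; rewrite EFinM -(egamma_fin a0) -egamma_fin; last by lra.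
by rewrite (egammaS a0) muleA -EFinM divff ?gt_eqF// mul1e.
Qed.

Lemma Gamma1 : Gamma (1 : R) = 1.
Proof. by apply: EFin_inj; rewrite -egamma_fin// egamma1. Qed.

Lemma ebetaE (a b : R) : 0 < a -> 0 < b ->
  ebeta a b = (Gamma a * Gamma b / Gamma (a + b))%:E.
Proof.
move=> a0 b0; have ab0 : 0 < a + b by rewrite addr_gt0.
have gn : Gamma (a + b) != 0 by rewrite gt_eqF// Gamma_gt0.
have := egammaM a b; rewrite !egamma_fin// => h.
have : (ebeta a b * (Gamma (a + b))%:E * (Gamma (a + b))^-1%:E =
   (Gamma a * Gamma b / Gamma (a + b))%:E)%E by rewrite -h -!EFinM.
by rewrite -muleA -EFinM (divff gn) mule1.
Qed.

End gamma.

(** * Binomial coefficients with a real upper argument *)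

Section binomials.
Context {R : realType}.
Implicit Types (a b : R) (n k j m : nat).

Lemma gbinom0 a : gbinom a 0 = 1.
Proof. by rewrite /gbinom big_ord0 fact0 divr1. Qed.

Lemma fact_neq0 k : (k`!%:R : R) != 0.
Proof. by rewrite pnatr_eq0 -lt0n fact_gt0. Qed.

Lemma gbinomS a k : k.+1%:R * gbinom a k.+1 = (a - k%:R) * gbinom a k.
Proof.
rewrite /gbinom big_ord_recr/= factS natrM.
by field; rewrite fact_neq0 addrC natr1 pnatr_eq0.
Qed.

Lemma gbinom_diag a k : k.+1%:R * gbinom (a + 1) k.+1 = (a + 1) * gbinom a k.
Proof.
rewrite /gbinom big_ord_recl/= subr0 factS natrM.
under eq_bigr => i _ do rewrite /bump/= natrD opprD addrA addrK.
by field; rewrite fact_neq0 addrC natr1 pnatr_eq0.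
Qed.

Lemma natr_bin_left n j :
  j.+1%:R * ('C(n, j.+1))%:R = (n%:R - j%:R) * ('C(n, j))%:R :> R.
Proof.
have [nj|jn] := ltnP n j.
  by rewrite !bin_small ?mulr0// ltnW// ltnS ltnW.
by rewrite -natrB// -!natrM mul_bin_left.
Qed.

Lemma natr_bin_diag n j :
  j.+1%:R * ('C(n.+1, j.+1))%:R = n.+1%:R * ('C(n, j))%:R :> R.
Proof. by rewrite -!natrM mul_bin_diag. Qed.

Lemma natr_bin_down n j :
  (n.+1%:R - j%:R) * ('C(n.+1, j))%:R = n.+1%:R * ('C(n, j))%:R :> R.
Proof.
have [nj|jn] := ltnP n.+1 j.
  by rewrite !bin_small ?mulr0// ltnW.
by rewrite -natrB// -!natrM mul_bin_down.
Qed.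

Lemma gbinom_nat n k : gbinom (n%:R : R) k = ('C(n, k))%:R.
Proof.
elim: k => [|k IH]; first by rewrite gbinom0 bin0.
have k0 : (k.+1%:R : R) != 0 by rewrite pnatr_eq0.
by apply: (mulfI k0); rewrite gbinomS IH natr_bin_left.
Qed.

Lemma gbinom_absorb a m t :
  gbinom a (m + t) * ('C(m + t, m))%:R = gbinom a m * gbinom (a - m%:R) t.
Proof.
elim: t => [|t IH]; first by rewrite addn0 binn gbinom0.
have t0 : (t.+1%:R : R) != 0 by rewrite pnatr_eq0.
have mt0 : ((m + t).+1%:R : R) != 0 by rewrite pnatr_eq0.
apply: (mulfI t0); rewrite addnS.
rewrite mulrCA -[RHS]mulrCA gbinomS.
have := natr_bin_down (m + t) m; rewrite -natrB; last by rewrite -addnS leq_addr.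
rewrite -{1}addnS addKn => ->.
rewrite mulrA [gbinom _ _ * _]mulrC gbinomS.
have -> : gbinom a m * ((a - m%:R - t%:R) * gbinom (a - m%:R) t) =
  (a - m%:R - t%:R) * (gbinom a m * gbinom (a - m%:R) t) by ring.
by rewrite -IH natrD; ring.
Qed.

(** By induction on [n]: splitting [n + 1 = s + (n + 1 - s)] in the product of
    [n + 1] with the next sum turns each half, by [gbinomS], into a multiple of
    the current one. *)
Lemma gbinom_Vandermonde a b n :
  \sum_(s < n.+1) gbinom a s * gbinom b (n - s) = gbinom (a + b) n.
Proof.
elim: n => [|n IH]; first by rewrite big_ord1 !gbinom0 mulr1.
have n0 : (n.+1%:R : R) != 0 by rewrite pnatr_eq0.
apply: (mulfI n0); rewrite gbinomS -IH !mulr_sumr.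
transitivity (\sum_(s < n.+2) (s%:R * gbinom a s * gbinom b (n.+1 - s))
  + \sum_(s < n.+2) (gbinom a s * ((n.+1 - s)%:R * gbinom b (n.+1 - s)))).
  rewrite -big_split/=; apply: eq_bigr => s _.
  rewrite natrB -1?ltnS//; ring.
rewrite big_ord_recl/= !mul0r add0r [X in _ + X]big_ord_recr/= subnn mul0r mulr0
  addr0.
rewrite -big_split/=; apply: eq_bigr => s _.
rewrite /bump/= add1n subSS gbinomS subSn -1?ltnS// gbinomS natrB -1?ltnS//; ring.
Qed.

(** The form in which Gamma quotients enter the Jacobi coefficients; it avoids
    dividing by [Gamma (c + 1)]. *)
Lemma gbinom_Gamma (c : R) k : 0 <= c ->
  gbinom (c + k%:R) k * Gamma (c + 1) * k`!%:R = Gamma (c + k%:R + 1).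
Proof.
move=> c0; elim: k => [|k IH]; first by rewrite gbinom0 fact0 addr0 mul1r mulr1.
have ck : 0 < c + k%:R + 1 by rewrite ltr_wpDl// addr_ge0.
rewrite -natr1 addrA (GammaS ck) -IH factS natrM.
have := gbinom_diag (c + k%:R) k => h.
transitivity ((k.+1%:R * gbinom (c + k%:R + 1) k.+1) * (Gamma (c + 1) * k`!%:R)).
  by ring.
by rewrite h; ring.
Qed.

End binomials.

(** * Jacobi and Legendre polynomials in powers of 1 + x *)

Section legendre.
Context {R : realType}.
Implicit Types (a b x y : R) (n k j m : nat).

(** [P_n^(1 - b, b)] as a polynomial in [y = 1 + x]; see [horner_jacobi]. *)
Definition jac b n : {poly R} :=
  \poly_(j < n.+1) ((-1) ^+ (n - j) * gbinom (n%:R + b) (n - j) *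
     ('C(n.+1 + j, j))%:R / 2 ^+ j).

Lemma size_jac b n : (size (jac b n) <= n.+1)%N.
Proof. exact: size_poly. Qed.

(** The Legendre polynomial [P_n^(0, 0)] in the same variable. *)
Definition leg n : {poly R} :=
  \poly_(j < n.+1) ((-1) ^+ (n - j) * ('C(n, j) * 'C(n + j, j))%:R / 2 ^+ j).

(** With [z = (1 + x) / 2], expand [(z - 1)^s z^(n - s)] in powers of [z] and
    exchange the sums. The coefficient of [z^(n - m)] is a sum over [s] in which
    [gbinom_absorb] extracts [gbinom (n + b) m], and Vandermonde's convolution
    evaluates the rest; [a + b = 1] makes it an ordinary binomial coefficient. *)
Lemma horner_jacobi a b n x : a + b = 1 ->
  (jacobi a b n).[x] = (jac b n).[1 + x].
Proof.
move=> ab; pose z : R := (1 + x) / 2.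
transitivity (\sum_(s < n.+1) gbinom (n%:R + a) (n - s) * gbinom (n%:R + b) s *
    ((z - 1) ^+ s * z ^+ (n - s))).
  rewrite /jacobi horner_sum; apply: eq_bigr => s _.
  rewrite hornerZ hornerM !horner_exp !hornerE.
  have -> : 2^-1 * (x - 1) = z - 1 by rewrite /z; field.
  by have -> : 2^-1 * (x + 1) = z by rewrite /z; field.
transitivity (\sum_(m < n.+1) (-1) ^+ m * z ^+ (n - m) *
   \sum_(s < n.+1) gbinom (n%:R + a) (n - s) * gbinom (n%:R + b) s * ('C(s, m))%:R).
  under [RHS]eq_bigr do rewrite mulr_sumr.
  rewrite exchange_big/=; apply: eq_bigr => s _.
  rewrite exprDn mulr_suml mulr_sumr.
  rewrite (big_ord_widen n.+1 (fun i => gbinom (n%:R + a) (n - s) * gbinom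
    (n%:R + b) s *
    (z ^+ (s - i) * (-1) ^+ i *+ 'C(s, i) * z ^+ (n - s)))) ?ltn_ord//.
  rewrite big_mkcond/=; apply: eq_bigr => m _.
  case: ifPn => [|/negbTE]; rewrite ltnS => ms; last first.
    by rewrite bin_small ?mulr0// ltnNge ms.
  have -> : (n - m = (s - m) + (n - s))%N.
    by rewrite addnC addnBA// subnK// -ltnS.
  by rewrite exprD -mulr_natr; ring.
rewrite horner_poly (reindex_inj rev_ord_inj)/=; apply: eq_bigr => j _.
rewrite subSS; have jn : (j <= n)%N by rewrite -ltnS.
rewrite subKn// exprMn exprVn.
have -> : \sum_(s < n.+1) gbinom (n%:R + a) (n - s) * gbinom (n%:R + b) s *
  ('C(s, n - j))%:R =
   gbinom (n%:R + b) (n - j) * ('C(n.+1 + j, j))%:R.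
  rewrite -(big_mkord xpredT (fun s => gbinom (n%:R + a) (n - s) * gbinom
    (n%:R + b) s * ('C(s, n - j))%:R)).
  rewrite (@big_cat_nat _ _ _ (n - j))//=; last by rewrite (leq_trans
    (leq_subr _ _)).
  rewrite big_nat_cond big1 ?add0r; last first.
    by move=> s /andP[/andP[_ h] _]; rewrite bin_small ?mulr0.
  rewrite -{1}(add0n (n - j)%N) big_addn.
  have -> : (n.+1 - (n - j) = j.+1)%N by rewrite subSn ?leq_subr// subKn.
  rewrite big_mkord.
  have -> : ('C(n.+1 + j, j))%:R = gbinom ((n%:R + b - (n - j)%:R) + (n%:R + a)) j.
    rewrite -gbinom_nat; congr gbinom.
    rewrite natrB// natrD -natr1; have -> : b = 1 - a by lra.
    by ring.
  rewrite -[gbinom (_ - _ + _) j]gbinom_Vandermonde mulr_sumr;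
    apply: eq_bigr => s _.
  have -> : (n - (s + (n - j)) = j - s)%N.
    by rewrite addnC subnDA subKn.
  rewrite -[LHS]mulrA (addnC s) gbinom_absorb; ring.
by set u := (2 ^+ j)^-1; ring.
Qed.

Lemma signrB n j : (j <= n)%N -> (-1) ^+ (n - j) = (-1) ^+ (n + j) :> R.
Proof. by move=> jn; rewrite -signr_odd oddB// -oddD signr_odd. Qed.

Lemma coef_leg n j : (leg n)`_j = (-1) ^+ (n + j) *
  ('C(n, j) * 'C(n + j, j))%:R / 2 ^+ j.
Proof.
rewrite /leg coef_poly ltnS; case: leqP => jn.
  by rewrite signrB.
by rewrite bin_small// mul0n mulr0 mul0r.
Qed.

Lemma coef_jac1 n j : (jac 1 n)`_j = (-1) ^+ (n + j) *
  ('C(n.+1, j.+1) * 'C(n.+1 + j, j))%:R / 2 ^+ j.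
Proof.
rewrite /jac coef_poly ltnS; case: leqP => jn.
  rewrite natr1 gbinom_nat (_ : 'C(n.+1, n - j) = 'C(n.+1, j.+1));
    last by rewrite -subSS bin_sub.
  rewrite natrM.
  by rewrite signrB// !mulrA.
by rewrite bin_small// mul0n mulr0 mul0r.
Qed.

Lemma coef_jac0 n j : (jac 0 n)`_j = (-1) ^+ (n + j) *
  ('C(n, j) * 'C(n.+1 + j, j))%:R / 2 ^+ j.
Proof.
rewrite /jac coef_poly ltnS; case: leqP => jn.
  rewrite addr0 gbinom_nat bin_sub// natrM.
  by rewrite signrB// !mulrA.
by rewrite bin_small// mul0n mulr0 mul0r.
Qed.

Lemma natr_neq0 k : (k.+1%:R : R) != 0.
Proof. by rewrite pnatr_eq0. Qed.

Lemma mulX_jac1 n : 'X * jac 1 n = leg n.+1 + leg n.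
Proof.
apply/polyP => -[|j]; rewrite coefXM coefD !coef_leg/=.
  by rewrite !bin0 !addn0 exprS; ring.
rewrite coef_jac1 !natrM.
have h1 := natr_bin_left (R := R) n j.
have h2 := natr_bin_left (R := R) (n.+1 + j) j.
have h3 : ('C(n.+1, j.+1))%:R = ('C(n, j.+1))%:R +
  ('C(n, j))%:R :> R by rewrite binS natrD.
have h4 : ('C(n.+1 + j.+1, j.+1))%:R = ('C(n.+1 + j, j.+1))%:R +
  ('C(n.+1 + j, j))%:R :> R.
  by rewrite addnS binS natrD.
have -> : ('C(n + j.+1, j.+1) = 'C(n.+1 + j, j.+1))%N by rewrite addnS addSn.
rewrite h3 h4; set a := 'C(n, j.+1)%:R in h1 *; set b := 'C(n, j)%:R in h1 *.
set c := 'C(n.+1 + j, j)%:R in h2 *; set d := 'C(n.+1 + j, j.+1)%:R in h2 *.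
(* Both sides are [(n + 1) / (j + 1)] times [b * c]. *)
have key : (a + b) * c = b * d.
  apply: (mulfI (natr_neq0 j)).
  have -> : j.+1%:R * ((a + b) * c) = j.+1%:R * a * c + j.+1%:R * b * c by ring.
  rewrite h1 mulrCA h2 natrD -!natr1; ring.
have s1 : (-1) ^+ (n.+1 + j.+1) = (-1) ^+ (n + j) :> R.
  by rewrite addSn addnS !exprS; ring.
have s2 : (-1) ^+ (n + j.+1) = - (-1) ^+ (n + j) :> R by rewrite addnS exprS; ring.
rewrite s1 s2 exprS invfM.
transitivity ((-1) ^+ (n + j) * (2 * ((a + b) * c)) / 2 / 2 ^+ j); first by field.
have -> : 2 * ((a + b) * c) = (a + b) * c + b * d by rewrite -key; ring.
by field.
Qed.

Lemma leg_jac0 n : (2 * n + 1)%:R *: leg n = n.+1%:R *: jac 0 n - n%:R *: jac 0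
  n.-1.
Proof.
case: n => [|n].
  rewrite scale0r subr0 muln0 add0n; congr (_ *: _); apply/polyP => j.
  rewrite coef_leg coef_jac0; case: j => [|j]; first by rewrite !bin0.
  by rewrite (@bin_small 0).
apply/polyP => j; rewrite coefB !coefZ coef_leg !coef_jac0 !natrM /=.
have h1 := natr_bin_down (R := R) n j.
have h2 : n.+2%:R * ('C(n.+2 + j, j))%:R = (n.+1 + j).+1%:R *
  ('C(n.+1 + j, j))%:R :> R.
  by rewrite -natr_bin_down -addSn natrD addrK.
have s1 : (-1) ^+ (n.+1 + j) = - (-1) ^+ (n + j) :> R by rewrite addSn exprS mulN1r.
rewrite s1; set u := (2 ^+ j)^-1; set s := (-1) ^+ (n + j).
have -> : n.+2%:R * (- s * ('C(n.+1, j)%:R * 'C(n.+2 + j, j)%:R) * u) =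
  - s * u * 'C(n.+1, j)%:R * (n.+2%:R * 'C(n.+2 + j, j)%:R) by ring.
have -> : n.+1%:R * (s * ('C(n, j)%:R * 'C(n.+1 + j, j)%:R) * u) =
  s * u * 'C(n.+1 + j, j)%:R * (n.+1%:R * 'C(n, j)%:R) by ring.
rewrite h2 -h1 -(natr1 (n.+1 + j)) !natrD natrM -natr1; ring.
Qed.

Let legc n j : R := ('C(n, j))%:R * ('C(n + j, j))%:R.

(** Multiplying by the square of [j + 1] expresses the neighbours
    [(n + 1, j + 1)], [(n, j + 1)] and [(n - 1, j + 1)] of the index [(n, j)]
    through the coefficient at [(n, j)] with no division, so that [leg_rec] needs
    no case distinction at the upper end of the support. *)
Lemma leg_coef_diag n j : j.+1%:R ^+ 2 * legc n.+1 j.+1 =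
  (n.+1%:R + j%:R) * (n.+2%:R + j%:R) * legc n j.
Proof.
rewrite /legc expr2; have h1 := natr_bin_diag (R := R) n j.
have h2 := natr_bin_diag (R := R) (n.+1 + j) j.
have h3 : n.+1%:R * ('C(n.+1 + j, j))%:R = (n + j).+1%:R * ('C(n + j, j))%:R :> R.
  by rewrite -natr_bin_down -addSn natrD addrK.
rewrite addnS.
transitivity ((j.+1%:R * 'C(n.+1, j.+1)%:R) *
  (j.+1%:R * 'C((n.+1 + j).+1, j.+1)%:R) : R).
  by ring.
rewrite h1 h2.
transitivity ((n.+1 + j).+1%:R * 'C(n, j)%:R * (n.+1%:R * 'C(n.+1 + j, j)%:R) : R);
  first by ring.
rewrite h3 -(natr1 (n.+1 + j)) -(natr1 (n + j)) !natrD -!natr1; ring.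
Qed.

Lemma leg_coef_right n j : j.+1%:R ^+ 2 * legc n j.+1 =
  (n%:R - j%:R) * (n.+1%:R + j%:R) * legc n j.
Proof.
rewrite /legc expr2; have h1 := natr_bin_left (R := R) n j.
have h2 := natr_bin_diag (R := R) (n + j) j.
rewrite addnS.
transitivity ((j.+1%:R * 'C(n, j.+1)%:R) * (j.+1%:R * 'C((n + j).+1, j.+1)%:R) : R).
  by ring.
rewrite h1 h2 -(natr1 (n + j)) !natrD -!natr1; ring.
Qed.

Lemma leg_coef_antidiag n j : j.+1%:R ^+ 2 * legc n j.+1 =
  (n%:R - j%:R) * (n.+1%:R - j%:R) * legc n.+1 j.
Proof.
rewrite /legc expr2; have h1 := natr_bin_left (R := R) n j.
have h2 := natr_bin_left (R := R) (n.+1 + j) j.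
have h3 := natr_bin_down (R := R) n j.
rewrite addnS -addSn.
transitivity ((j.+1%:R * 'C(n, j.+1)%:R) * (j.+1%:R * 'C(n.+1 + j, j.+1)%:R) : R).
  by ring.
rewrite h1 h2.
transitivity ((n%:R - j%:R) * ((n.+1%:R - j%:R) * ('C(n.+1, j))%:R) *
  ('C(n.+1 + j, j))%:R : R); last by ring.
rewrite h3 natrD; ring.
Qed.

(** Bonnet's recurrence. *)
Lemma leg_rec n : n.+2%:R *: leg n.+2 =
  (2 * n + 3)%:R *: (('X - 1) * leg n.+1) - n.+1%:R *: leg n.
Proof.
apply/polyP => j; rewrite coefB !coefZ mulrBl mul1r coefB coefXM !coef_leg !natrM.
case: j => [|j] /=.
  by rewrite !bin0 !addn0 natrD natrM !exprS -!(natr1 n.+1) -!natr1; field.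
rewrite -!/(legc _ _) exprS.
have s0 : (-1) ^+ (n.+1 + j.+1) = (-1) ^+ (n + j) :> R.
  by rewrite addSn addnS !exprS; ring.
have s1 : (-1) ^+ (n.+1 + j) = - (-1) ^+ (n + j) :> R by rewrite addSn exprS; ring.
have s2 : (-1) ^+ (n + j.+1) = - (-1) ^+ (n + j) :> R by rewrite addnS exprS; ring.
have s3 : (-1) ^+ (n.+2 + j.+1) = - (-1) ^+ (n + j) :> R.
  by rewrite 2!addSn addnS !exprS; ring.
rewrite s0 s1 s2 s3 invfM; set s := (-1) ^+ _; set u := (2 ^+ j)^-1.
have key : n.+2%:R * legc n.+2 j.+1 =
  (2 * n + 3)%:R * (2 * legc n.+1 j + legc n.+1 j.+1) - n.+1%:R * legc n j.+1.
  apply: (mulfI (expf_neq0 2 (natr_neq0 j))).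
  have -> : j.+1%:R ^+ 2 * (n.+2%:R * legc n.+2 j.+1) =
    n.+2%:R * (j.+1%:R ^+ 2 * legc n.+2 j.+1) by ring.
  have -> : j.+1%:R ^+ 2 * ((2 * n + 3)%:R * (2 * legc n.+1 j + legc n.+1 j.+1) -
    n.+1%:R * legc n j.+1)
    = (2 * n + 3)%:R * (2 * j.+1%:R ^+ 2 * legc n.+1 j + j.+1%:R ^+ 2 * legc n.+1
    j.+1)
      - n.+1%:R * (j.+1%:R ^+ 2 * legc n j.+1) by ring.
  rewrite (leg_coef_diag n.+1) (leg_coef_right n.+1)
    (leg_coef_antidiag n) natrD natrM -!(natr1 n.+2) -!(natr1 n.+1) -!natr1; ring.
transitivity (- (s * u * 2^-1) * (n.+2%:R * legc n.+2 j.+1)); first by ring.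
by rewrite key; field.
Qed.

Lemma leg0 : leg 0 = 1.
Proof.
apply/polyP => -[|j]; rewrite coef_leg coef1/=; first by rewrite !expr0 divr1 mul1r.
by rewrite bin_small// mul0n mulr0 mul0r.
Qed.

Lemma leg1 : leg 1 = 'X - 1.
Proof.
apply/polyP => -[|[|j]]; rewrite coef_leg coefB coefX coef1/=.
- by rewrite !bin0 addn0 expr1 expr0; field.
- by rewrite subr0 (_ : 'C(1, 1) * 'C(1 + 1, 1) = 2)%N// expr1 addn1 sqrrN expr1n;
field.
- by rewrite bin_small// mul0n mulr0 mul0r subr0.
Qed.

Lemma horner_leg0 x : (leg 0).[x] = 1.
Proof. by rewrite leg0 hornerE. Qed.

Lemma horner_leg1 x : (leg 1).[1 + x] = x.
Proof. by rewrite leg1 hornerD hornerN hornerX hornerC addrAC subrr add0r. Qed.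

Lemma horner_leg_rec n x : n.+2%:R * (leg n.+2).[1 + x] =
  (2 * n + 3)%:R * (x * (leg n.+1).[1 + x]) - n.+1%:R * (leg n).[1 + x].
Proof.
have := congr1 (fun p => p.[1 + x]) (leg_rec n).
rewrite hornerD hornerN !hornerZ hornerM !hornerE => ->.
by rewrite (_ : 1 + x - 1 = x)//; ring.
Qed.

(** By [leg_rec], [P_(n+2) - x P_(n+1)] is [(n + 1) / (n + 2)] times
    [x P_(n+1) - P_n]; since the left-hand side is symmetric in the two
    polynomials, it does not increase with [n]. For [n = 0] it is [1 - x^2]. *)
Lemma leg_energy n x : x ^+ 2 <= 1 ->
  (1 - x ^+ 2) * (leg n.+1).[1 + x] ^+ 2 + ((leg n).[1 + x] - x *
  (leg n.+1).[1 + x]) ^+ 2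
  <= 1 - x ^+ 2.
Proof.
move=> x1; elim: n => [|n IH].
  rewrite horner_leg0 horner_leg1 le_eqVlt; apply/orP; left; apply/eqP; ring.
apply: le_trans IH.
set p := (leg n).[_]; set r := (leg n.+1).[_]; set t := (leg n.+2).[_].
have h : n.+2%:R * (t - x * r) = n.+1%:R * (x * r - p).
  rewrite mulrBr horner_leg_rec -/p -/r natrD natrM -(natr1 n.+1) -natr1; ring.
have n2 : 0 < n.+2%:R :> R by rewrite ltr0n.
pose d := n.+1%:R / n.+2%:R : R.
have d0 : 0 <= d by rewrite divr_ge0.
have d1 : d <= 1 by rewrite ler_pdivrMr// mul1r ler_nat.
have {}h : t = x * r + d * (x * r - p).
  have : t - x * r = d * (x * r - p).
    by apply: (mulfI (lt0r_neq0 n2)); rewrite h /d mulrA mulrCA mulfV ?mulr1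
      ?gt_eqF.
  by lra.
have -> : (1 - x ^+ 2) * t ^+ 2 + (r - x * t) ^+ 2 =
  (1 - x ^+ 2) * r ^+ 2 + (t - x * r) ^+ 2.
  by ring.
rewrite lerD2l h addrAC subrr add0r exprMn -[leRHS]sqrrN opprB.
by rewrite ler_piMl ?sqr_ge0// expr_le1.
Qed.

(** At the end points, where [leg_energy] gives no information. *)
Lemma leg_end n x : x ^+ 2 = 1 -> (leg n).[1 + x] = x ^+ n.
Proof.
move=> x1; suff : (leg n).[1 + x] = x ^+ n /\ (leg n.+1).[1 + x] =
x ^+ n.+1 by case.
elim: n => [|n [h1 h2]]; first by rewrite horner_leg0 horner_leg1.
split => //; apply: (mulfI (natr_neq0 n.+1)).
rewrite horner_leg_rec h1 h2.
have -> : x ^+ n.+2 = x ^+ n by rewrite -addn2 exprD x1 mulr1.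
have -> : x * x ^+ n.+1 = x ^+ n by rewrite -exprS -addn2 exprD x1 mulr1.
rewrite natrD natrM -(natr1 n.+1) -natr1; ring.
Qed.

Lemma leg_le1 n x : -1 <= x <= 1 -> `|(leg n).[1 + x]| <= 1.
Proof.
move=> x1.
have x2 : x ^+ 2 <= 1 by rewrite -real_normK ?num_real// expr_le1// ler_norml.
have [e|ne] := eqVneq (x ^+ 2) 1.
  by rewrite leg_end// normrX exprn_ile1// ler_norml.
case: n => [|n]; first by rewrite horner_leg0 normr1.
have h := leg_energy n x2.
have lt : 0 < 1 - x ^+ 2 by rewrite subr_gt0 lt_neqAle ne.
rewrite -(@expr_le1 _ 2)// real_normK ?num_real//.
rewrite -(ler_pM2l lt) mulr1; apply: le_trans h.
by rewrite lerDl sqr_ge0.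
Qed.

(** Summing [leg_jac0], [(n + 1) P_n^(1, 0)] is the sum of the
    [(2k + 1) P_k] for [k <= n], which is at most [(n + 1)^2] in absolute value. *)
Lemma jac0_le n x : -1 <= x <= 1 -> `|(jac 0 n).[1 + x]| <= n.+1%:R.
Proof.
move=> x1.
suff H m : m.+1%:R * `|(jac 0 m).[1 + x]| <= m.+1%:R ^+ 2.
  by have := H n; rewrite expr2 ler_pM2l ?ltr0n.
have step k : k.+1%:R * (jac 0 k).[1 + x] = (2 * k + 1)%:R *
  (leg k).[1 + x] + k%:R * (jac 0 k.-1).[1 + x].
  have := congr1 (fun p => p.[1 + x]) (leg_jac0 k).
  by rewrite hornerD hornerN !hornerZ => ->; rewrite subrK.
elim: m => [|m IH].
  have := step 0; rewrite mul0r addr0 muln0 add0n !mul1r expr1n => ->.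
  exact: leg_le1.
rewrite -(ger0_norm (ler0n R m.+2)) -normrM step/=.
apply: (le_trans (ler_normD _ _)).
rewrite !normrM !normr_nat.
apply: (@le_trans _ _ ((2 * m.+1 + 1)%:R * 1 + m.+1%:R ^+ 2)).
  apply: lerD; last exact: IH.
  by apply: ler_wpM2l => //; exact: leg_le1.
by rewrite natrD natrM -(natr1 m.+1) le_eqVlt; apply/orP; left; apply/eqP; ring.
Qed.

Lemma jac_at0 b n : (jac b n).[0] = (-1) ^+ n * gbinom (n%:R + b) n.
Proof.
by rewrite horner_coef0 /jac coef_poly/= subn0 addn0 bin0 expr0 divr1 mulr1.
Qed.

End legendre.

(** * Fractional integrals of polynomials *)

Section integrable_EFin.
Context {R : realType} (D : set R) (mD : measurable D).
Local Notation mu := (@lebesgue_measure R).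
Implicit Types f g : R -> R.

Lemma integrableZl_EFin c f : mu.-integrable D (EFin \o f) ->
  mu.-integrable D (EFin \o (fun t => c * f t)).
Proof.
by move=> If; have := @integrableZl _ _ _ mu D mD c _ If; apply: eq_integrable.
Qed.

Lemma integrableD_EFin f g : mu.-integrable D (EFin \o f) ->
  mu.-integrable D (EFin \o g) -> mu.-integrable D (EFin \o (fun t => f t + g t)).
Proof.
by move=> If Ig; have := @integrableD _ _ _ mu D mD _ _ If Ig; apply: eq_integrable.
Qed.

Lemma eq_integrable_EFin f g : {in D, f =1 g} ->
  mu.-integrable D (EFin \o f) -> mu.-integrable D (EFin \o g).
Proof.
move=> fg; apply: (@eq_integrable _ _ _ mu D mD) => t tD.
by rewrite /= fg.
Qed.

End integrable_EFin.

Section frac_poly.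
Context {R : realType}.
Local Notation mu := (@lebesgue_measure R).
Implicit Types (nu b x y t : R) (p q : {poly R}) (n j N : nat).

(** The diagonal entries of [diagQ nu b]. *)
Definition gratio nu b j : R := Gamma (b + j%:R + 1) / Gamma (b + nu + j%:R + 1).

Definition frac_mono nu b y j : R := gratio nu b j * y `^ (b + nu + j%:R).

(** The fractional integral of order [nu] of [(1 + t)^b q(1 + t)] at [x = y - 1];
    see [frac_poly_integral]. The formula extends the integral to [nu = 0], where
    it is the identity ([frac_poly0]). *)
Definition frac_poly nu b y q : R :=
  \sum_(j < size q) q`_j * frac_mono nu b y j.

Lemma frac_polyE nu b y q N : (size q <= N)%N ->
  frac_poly nu b y q = \sum_(j < N) q`_j * frac_mono nu b y j.
Proof.
move=> qN; rewrite /frac_poly (big_ord_widen N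
  (fun j => q`_j * frac_mono nu b y j))//.
rewrite big_mkcond/=; apply: eq_bigr => j _; case: ltnP => // h.
by rewrite nth_default// mul0r.
Qed.

Lemma frac_polyD nu b y p q :
  frac_poly nu b y (p + q) = frac_poly nu b y p + frac_poly nu b y q.
Proof.
rewrite !(@frac_polyE _ _ _ _ (maxn (size p) (size q))) ?leq_maxl ?leq_maxr//;
  last exact: size_polyD.
by rewrite -big_split/=; apply: eq_bigr => j _; rewrite coefD mulrDl.
Qed.

Lemma frac_polyZ nu b y c q : frac_poly nu b y (c *: q) = c * frac_poly nu b y q.
Proof.
rewrite (@frac_polyE _ _ _ (c *: q) (size q)) ?size_scale_leq//.
by rewrite mulr_sumr; apply: eq_bigr => j _; rewrite coefZ mulrA.
Qed.

Lemma frac_polyMX nu b y q : frac_poly nu b y ('X * q) = frac_poly nu (b + 1) y q.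
Proof.
rewrite (@frac_polyE _ _ _ ('X * q) (size q).+1); last first.
  by rewrite (leq_trans (size_polyMleq _ _))// size_polyX.
rewrite big_ord_recl coefXM mul0r add0r; apply: eq_bigr => j _.
rewrite coefXM/= /frac_mono /gratio /bump/= add1n -!natr1.
have -> : b + 1 + j%:R = b + (j%:R + 1) :> R by ring.
by have -> : b + 1 + nu + j%:R = b + nu + (j%:R + 1) :> R by ring.
Qed.

Lemma Gamma_neq0 (a : R) : 0 < a -> Gamma a != 0.
Proof. by move=> a0; rewrite gt_eqF// Gamma_gt0. Qed.

Lemma frac_poly0 b y q : 0 <= b -> 0 < y -> frac_poly 0 b y q = y `^ b * q.[y].
Proof.
move=> b0 y0; rewrite horner_coef mulr_sumr; apply: eq_bigr => j _.
have bj : 0 < b + j%:R + 1 by rewrite ltr_wpDl// addr_ge0.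
rewrite /frac_mono /gratio addr0 divff ?Gamma_neq0// mul1r mulrCA; congr (_ * _).
rewrite powRD; last by rewrite (gt_eqF y0) implybT.
by rewrite powR_mulrn// ltW.
Qed.

(** Coefficient by coefficient: by [gbinom_Gamma], [gbinom (n + c) (n - j)] times
    [Gamma (c + j + 1)] is [Gamma (c + n + 1) / (n - j)!]. Comparing [c = b] with
    [c = b + m], the quotient does not depend on [j]. *)
Lemma frac_poly_jac nu m b y n : 0 <= b -> 0 <= m ->
  frac_poly (nu + m) b y (jac b n) =
  gratio m b n * frac_poly nu (b + m) y (jac (b + m) n).
Proof.
move=> b0 m0; rewrite !(@frac_polyE _ _ _ (jac _ _) n.+1) ?size_jac//.
rewrite mulr_sumr; apply: eq_bigr => j _.
have jn : (j <= n)%N by rewrite -ltnS.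
rewrite /jac !coef_poly ltn_ord /frac_mono /gratio.
have -> : b + (nu + m) = b + m + nu by ring.
have h (c : R) : 0 <= c ->
    gbinom (n%:R + c) (n - j) * Gamma (c + j%:R + 1) * (n - j)`!%:R =
    Gamma (c + n%:R + 1).
  move=> c0; have := gbinom_Gamma (n - j) (addr_ge0 c0 (ler0n R j)).
  by rewrite natrB// -addrA (addrCA j%:R) subrr addr0 (addrC c n%:R).
have bm0 : 0 <= b + m by rewrite addr_ge0.
have gbm : Gamma (b + m + n%:R + 1) != 0.
  by rewrite Gamma_neq0// ltr_wpDl// addr_ge0.
have key : gbinom (n%:R + b) (n - j) * Gamma (b + j%:R + 1) =
    Gamma (b + n%:R + 1) / Gamma (b + m + n%:R + 1) *
   (gbinom (n%:R + (b + m)) (n - j) * Gamma (b + m + j%:R + 1)).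
  apply: (mulIf (fact_neq0 (n - j))).
  by rewrite -[RHS]mulrA (h _ b0) (h _ bm0) (divfK gbm).
set u := _ `^ _; set G2 := Gamma (_ + _ + nu + _ + _).
set s := (-1) ^+ _; set c := 'C(_, _)%:R; set v := 2 ^+ j.
transitivity (s * c * v^-1 * G2^-1 * u *
  (gbinom (n%:R + b) (n - j) * Gamma (b + j%:R + 1))); first by ring.
rewrite key; move: (Gamma (b + n%:R + 1)) (Gamma (b + m + n%:R + 1)) (Gamma
  (b + m + j%:R + 1)) G2.
by move=> ? ? ? ?; ring.
Qed.

Lemma integral_frac_mono nu g x : 0 < nu -> 0 <= g -> -1 < x ->
  (\int[mu]_(t in `](-1)%R, x[) ((1 + t) `^ g * (x - t) `^ (nu - 1))%:E =
   (Gamma nu * (Gamma (g + 1) / Gamma (g + nu + 1) * (1 + x) `^ (g + nu)))%:E)%E.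
Proof.
move=> nu0 g0 x1.
have g1 : 0 < g + 1 by lra.
have y0 : 0 < 1 + x by lra.
pose f (s : R) := (pospow (g + 1) s * pospow nu (1 + x - s))%:E.
transitivity (\int[mu]_t f t)%E; last first.
  rewrite /f ebeta_scale ebetaE// -EFinM pospow_gt0E//; congr EFin.
  have -> : g + 1 + nu - 1 = g + nu by ring.
  have -> : g + 1 + nu = g + nu + 1 by ring.
  set a1 := Gamma _; set a2 := Gamma _; set a3 := Gamma _; set u := _ `^ _.
  by ring.
rewrite (ge0_integral_affine 1 ltr01 (measurable_beta_integrand (g + 1) nu
  (1 + x))); last first.
  by move=> t; rewrite lee_fin mulr_ge0// pospow_ge0.
rewrite mul1e integral_mkcond; apply: eq_integral => t _.
have -> : 1 + x - (1 * t + 1) = x - t by ring.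
have -> : 1 * t + 1 = 1 + t by ring.
rewrite patchE; case: ifPn; rewrite ?inE ?notin_setE /= in_itv/=.
  move=> /andP[t0 t1]; rewrite !pospow_gt0E ?subr_gt0//; last by lra.
  by rewrite addrK.
move=> /negP; rewrite negb_and -!leNgt => /orP[t0|t1].
  by rewrite pospow_le0 ?mul0r//; lra.
by rewrite [X in _ * X]pospow_le0 ?mulr0//; lra.
Qed.

Definition frac_weight nu b x t : R := (1 + t) `^ b * (x - t) `^ (nu - 1).

Lemma measurable_frac_weight nu b x (D : set R) : measurable_fun D
  (frac_weight nu b x).
Proof.
apply: measurable_funTS; apply: measurable_funM.
  by apply: (measurableT_comp (measurable_powR b)); exact: measurable_funD.
by apply: (measurableT_comp (measurable_powR _)); exact: measurable_funB.
Qed.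

Lemma frac_weight_ge0 nu b x t : 0 <= frac_weight nu b x t.
Proof. by rewrite mulr_ge0 ?powR_ge0. Qed.

Lemma integrable_frac_weight nu b x : 0 < nu -> 0 <= b -> -1 < x ->
  mu.-integrable `]-1, x[ (EFin \o frac_weight nu b x).
Proof.
move=> nu0 b0 x1; apply/integrableP; split.
  by apply/measurable_EFinP; exact: measurable_frac_weight.
under eq_integral do rewrite /= ger0_norm ?frac_weight_ge0//.
by rewrite integral_frac_mono// ltry.
Qed.

Lemma frac_weightS nu b x t : -1 < t ->
  (1 + t) * frac_weight nu b x t = frac_weight nu (b + 1) x t.
Proof.
move=> t1; have t0 : 0 < 1 + t by lra.
rewrite /frac_weight (@powRD _ (1 + t) b 1); last by rewrite (gt_eqF t0) implybT.
rewrite powRr1; last exact: ltW.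
by rewrite mulrA (mulrC (1 + t)).
Qed.

(** Induction on the polynomial, for all [b] at once: multiplying [q] by the
    variable amounts to increasing [b] by one. *)
Lemma frac_poly_integral nu b x q : 0 < nu -> 0 <= b -> -1 < x ->
  mu.-integrable `]-1, x[ (EFin \o (fun t => q.[1 + t] * frac_weight nu b x t)) /\
  \int[mu]_(t in `]-1, x[) (q.[1 + t] * frac_weight nu b x t) =
    Gamma nu * frac_poly nu b (1 + x) q.
Proof.
move=> nu0 + x1; elim/poly_ind: q b => [|q c IH] b b0.
  under [X in _.-integrable _ (EFin \o X)]eq_fun do rewrite horner0 mul0r.
  under eq_Rintegral do rewrite horner0 mul0r.
  split; first exact: integrable0.
  by rewrite Rintegral_cst// /frac_poly size_poly0 big_ord0 mulr0 mul0r.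
have b1 : 0 <= b + 1 by lra.
have [I1 E1] := IH _ b1.
have I2 := integrable_frac_weight nu0 b0 x1.
have I3 : mu.-integrable `]-1, x[ (EFin \o (fun t => c * frac_weight nu b x t)).
  exact: integrableZl_EFin.
have e t : t \in `]-1, x[%classic ->
    (q * 'X + c%:P).[1 + t] * frac_weight nu b x t =
    q.[1 + t] * frac_weight nu (b + 1) x t + c * frac_weight nu b x t.
  rewrite inE/= in_itv/= => /andP[t1 _].
  by rewrite -frac_weightS// hornerMXaddC mulrDl -[q.[_] * _ * _]mulrA.
split.
  apply: (eq_integrable_EFin _ _ (integrableD_EFin _ I1 I3)) => //.
  by move=> t tx; rewrite e.
transitivity (\int[mu]_(t in `]-1, x[)
    (q.[1 + t] * frac_weight nu (b + 1) x t + c * frac_weight nu b x t)).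
  by apply: eq_Rintegral => t /e.
rewrite RintegralD// E1 RintegralZl//.
rewrite /Rintegral integral_frac_mono//=.
rewrite (mulrC q 'X) frac_polyD frac_polyMX mulrDr; congr (_ + _).
rewrite -(mulr1 c%:P) mul_polyC frac_polyZ /frac_poly size_poly1 big_ord1 coef1
  mul1r.
rewrite /frac_mono /gratio addr0.
have -> : b + nu + 0 = b + nu by rewrite addr0.
by rewrite mulrCA.
Qed.

(** Fractional integration is given by a positive kernel. *)
Lemma frac_poly_le_gt0 nu b x q (M : R) : 0 < nu -> 0 <= b -> -1 < x ->
  (forall t, -1 <= t <= x -> `|q.[1 + t]| <= M) ->
  `|frac_poly nu b (1 + x) q| <= M * frac_poly nu b (1 + x) 1.
Proof.
move=> nu0 b0 x1 qM.
have [Iq Eq] := frac_poly_integral q nu0 b0 x1.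
have [I1 E1] := frac_poly_integral 1 nu0 b0 x1.
have G0 := Gamma_gt0 nu0.
rewrite -(ler_pM2l G0) -{1}(gtr0_norm G0) -normrM -Eq.
have -> : Gamma nu * (M * frac_poly nu b (1 + x) 1) =
    M * (Gamma nu * frac_poly nu b (1 + x) 1) by rewrite mulrCA.
rewrite -E1 -RintegralZl//.
apply: (le_trans (le_normr_Rintegral _ Iq)) => //.
apply: le_Rintegral => //.
- by apply: integrable_norm.
- exact: integrableZl_EFin.
move=> t /=; rewrite in_itv/= => /andP[t1 t2].
rewrite normrM (ger0_norm (frac_weight_ge0 _ _ _ _)) hornerC mul1r ler_wpM2r
  ?frac_weight_ge0//.
by apply: qM; rewrite !ltW.
Qed.

End frac_poly.

(** * Sup norms of Jacobi polynomials *)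

Section sup_norm.
Context {R : realType}.
Implicit Types (nu b m x y t : R) (n : nat).

Definition jac_norm b n : R := sup [set `|(jac b n).[1 + x]| | x in `[-1, 1]].

Lemma jac_norm_has_ubound b n :
  has_ubound [set `|(jac b n).[1 + x]| | x in `[(-1 : R), 1]].
Proof.
exists (\sum_(j < size (jac b n)) `|(jac b n)`_j| * 2 ^+ j) => _ [x /= + <-].
rewrite in_itv/= => /andP[x1 x2]; rewrite horner_coef.
apply: (le_trans (ler_norm_sum _ _ _)); apply: ler_sum => j _.
rewrite normrM normrX ler_wpM2l//.
by rewrite lerXn2r ?nnegrE// ger0_norm; lra.
Qed.

Lemma jac_norm_ub b n x : -1 <= x <= 1 -> `|(jac b n).[1 + x]| <= jac_norm b n.
Proof.
move=> x1; apply: (ub_le_sup (jac_norm_has_ubound b n)).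
by exists x => //=; rewrite in_itv.
Qed.

Lemma jac_norm_le b n c : (forall x, -1 <= x <= 1 -> `|(jac b n).[1 + x]| <= c) ->
  jac_norm b n <= c.
Proof.
move=> h; apply: ge_sup.
  by exists `|(jac b n).[1 + 1]|, 1 => //=; rewrite in_itv/= lexx andbT; lra.
by move=> _ [x /= + <-]; rewrite in_itv/=; exact: h.
Qed.

Lemma jac_norm_ge0 b n : 0 <= jac_norm b n.
Proof. by apply: (le_trans (normr_ge0 _)) (@jac_norm_ub b n 1 _); lra. Qed.

Lemma jac_norm0_le n : jac_norm 0 n <= n.+1%:R.
Proof. by apply: jac_norm_le => x; exact: jac0_le. Qed.

Lemma gbinom_ge0 b n k : 0 <= b -> (k <= n)%N -> 0 <= gbinom (n%:R + b) k.
Proof.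
move=> b0 kn; rewrite /gbinom divr_ge0// prodr_ge0// => i _.
rewrite addrAC addr_ge0// subr_ge0 ler_nat.
by rewrite (leq_trans _ kn)// ltnW.
Qed.

Lemma gbinom_le_jac_norm b n : 0 <= b -> gbinom (n%:R + b) n <= jac_norm b n.
Proof.
move=> b0; have := @jac_norm_ub b n (-1).
rewrite subrr jac_at0 normrM normrX normrN normr1 expr1n mul1r => h.
by apply: (le_trans (ler_norm _)); apply: h; lra.
Qed.

Lemma frac_poly_le nu b x q (M : R) : 0 <= nu -> 0 <= b -> -1 < x ->
  (forall t, -1 <= t <= x -> `|q.[1 + t]| <= M) ->
  `|frac_poly nu b (1 + x) q| <= M * frac_poly nu b (1 + x) 1.
Proof.
rewrite le_eqVlt => /predU1P[<-|nu0]; last exact: frac_poly_le_gt0.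
move=> b0 x1 qM; have y0 : 0 < 1 + x by lra.
rewrite !frac_poly0// hornerC mulr1 normrM ger0_norm ?powR_ge0// mulrC.
by rewrite ler_wpM2r ?powR_ge0// qM// lexx andbT ltW.
Qed.

Lemma gratio_ge0 m b n : 0 <= m -> 0 <= b -> 0 <= gratio m b n.
Proof.
by move=> m0 b0; apply: divr_ge0; apply/ltW/Gamma_gt0; rewrite ltr_wpDl// !addr_ge0.
Qed.

(** At [x = -1] the absolute values of the polynomials compared in
    [gratio_jac_norm] are these binomials, and both sides agree. *)
Lemma gratio_gbinom m b n : 0 <= m -> 0 <= b ->
  gratio m b n * gbinom (n%:R + (b + m)) n = gratio m b 0 * gbinom (n%:R + b) n.
Proof.
move=> m0 b0; rewrite /gratio !addr0.
have h (c : R) : 0 <= c -> gbinom (n%:R + c) n * Gamma (c + 1) * n`!%:R =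
  Gamma (c + n%:R + 1).
  by move=> c0; rewrite -gbinom_Gamma// (addrC n%:R c).
have bm0 : 0 <= b + m by rewrite addr_ge0.
rewrite -(h _ b0) -(h _ bm0).
have g0 : gbinom (n%:R + (b + m)) n != 0.
  apply/eqP => e; have : Gamma (b + m + n%:R + 1) != 0.
    by rewrite Gamma_neq0// ltr_wpDl// addr_ge0.
  by rewrite -h// e !mul0r eqxx.
have : Gamma (b + m + 1) != 0 by rewrite Gamma_neq0// ltr_wpDl.
have := fact_neq0 (R := R) n.
move: (Gamma _) (Gamma _) (n`!%:R) => u v w w0 v0; field.
by rewrite w0 v0 g0.
Qed.

(** For [x > -1], [frac_poly_jac] writes [gratio m b n] times the polynomial of
    parameter [b + m] as a fractional integral of [jac b n] divided by
    [(1 + x)^(b + m)]; the same power appears in the bound [frac_poly_le_gt0] and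
    cancels. *)
Lemma gratio_jac_norm m b n : 0 < m -> 0 <= b ->
  gratio m b n * jac_norm (b + m) n <= gratio m b 0 * jac_norm b n.
Proof.
move=> m0 b0; have g0 k : 0 <= gratio m b k by apply: gratio_ge0 => //; exact: ltW.
have bm0 : 0 <= b + m by rewrite addr_ge0// ltW.
have [ge|gn] := eqVneq (gratio m b n) 0.
  by rewrite ge mul0r mulr_ge0// jac_norm_ge0.
have gp : 0 < gratio m b n by rewrite lt_neqAle eq_sym gn g0.
rewrite mulrC -ler_pdivlMr//; apply: jac_norm_le => x /andP[x1 x2].
rewrite ler_pdivlMr// mulrC.
(* The power of [1 + x] vanishes at [x = -1], which is treated separately. *)
have [xe|xn] := eqVneq x (-1).
  rewrite xe subrr jac_at0 normrM normrX normrN normr1 expr1n mul1r.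
  rewrite (ger0_norm (gbinom_ge0 bm0 (leqnn n))) (gratio_gbinom n (ltW m0) b0).
  by rewrite ler_wpM2l// gbinom_le_jac_norm.
have {xn}x1 : -1 < x by rewrite lt_neqAle eq_sym xn.
have y0 : 0 < 1 + x by lra.
have yb : 0 < (1 + x) `^ (b + m) by rewrite powR_gt0.
rewrite -(ler_pM2l yb).
have : `|frac_poly m b (1 + x) (jac b n)| <= jac_norm b n * frac_poly m b (1 + x) 1.
  apply: frac_poly_le_gt0 => // t /andP[t1 t2]; apply: jac_norm_ub.
  by rewrite t1 (le_trans t2).
rewrite -{1}(add0r m) (frac_poly_jac 0 _ n b0 (ltW m0)) (frac_poly0 _ bm0 y0).
rewrite (normrM (gratio _ _ _)) (normrM (_ `^ _)) (ger0_norm (g0 n)) (ger0_norm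
  (ltW yb)) => h.
rewrite mulrCA (le_trans h)//.
rewrite /frac_poly size_poly1 big_ord1 coef1 mul1r /frac_mono addr0.
by rewrite mulrC -mulrA mulrCA mulrA.
Qed.

Lemma Gamma_nat n : Gamma (n%:R + 1) = n`!%:R :> R.
Proof.
have := gbinom_Gamma n (lexx (0 : R)).
by rewrite !add0r Gamma1 mulr1 gbinom_nat binn mul1r.
Qed.

(** When [b + m = 1] the left-hand side is [Gamma (b + 1)] times the absolute value
    of [jac b n] at [x = -1]. *)
Lemma gratio_corner m b n : 0 <= b -> b + m = 1 ->
  gratio m b n * n.+1%:R <= Gamma (b + 1) * jac_norm b n.
Proof.
move=> b0 bm; have G0 : 0 < Gamma (b + 1) by rewrite Gamma_gt0// ltr_wpDl.
rewrite /gratio bm (_ : 1 + n%:R = n.+1%:R); last by rewrite -natr1 addrC.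
rewrite Gamma_nat -(gbinom_Gamma n b0) (addrC b n%:R).
have -> : gbinom (n%:R + b) n * Gamma (b + 1) * n`!%:R / n.+1`!%:R * n.+1%:R =
   Gamma (b + 1) * gbinom (n%:R + b) n.
  rewrite factS natrM; move: (Gamma _) => u; field.
  by rewrite fact_neq0 addrC natr1 pnatr_eq0.
by apply: ler_wpM2l; [exact: ltW|exact: gbinom_le_jac_norm].
Qed.

End sup_norm.

(** * Series and the matrices R and S *)

Section series.
Context {R : realType}.
Implicit Types (a c g L d : R^nat).

Lemma cvg_series_shift d : cvgn (series d) -> cvgn (series (fun n => d n.+1)).
Proof.
move=> h; have -> : series (fun n => d n.+1) = (fun n => series d n.+1 - d 0%N).
  apply/funext => n; rewrite /series/= big_nat_recl//.
  by rewrite addrAC subrr add0r.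
apply: is_cvgB; last exact: is_cvg_cst.
by have /cvg_ex[l hl] := h; apply/cvg_ex; exists l; rewrite (cvg_shiftS (series d)).
Qed.

Lemma cvg_series_unshift d : cvgn (series d) ->
  cvgn (series (fun n => if n is m.+1 then d m else 0)).
Proof.
move=> /cvg_ex[l hl]; apply/cvg_ex; exists l; rewrite -cvg_shiftS /=.
have -> : (fun n => series (fun n => if n is m.+1 then d m else 0) n.+1) = series d.
  by apply/funext => n; rewrite /series/= big_nat_recl// add0r.
exact: hl.
Qed.

Lemma series_dom_cvg (d e : R^nat) : (forall n, `|d n| <= e n) -> cvgn (series e) ->
  cvgn (series d).
Proof.
move=> de ce; apply: normed_cvg; apply: series_le_cvg ce => n //=.
by apply: le_trans (de n).
Qed.

Lemma cvg_seriesZ (k : R) d : cvgn (series d) -> cvgn (series (fun n => k * d n)).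
Proof. by move=> h; exact: (is_cvg_seriesZ (k := k)). Qed.

Lemma cvg_seriesD d e : cvgn (series d) -> cvgn (series e) ->
  cvgn (series (fun n => d n + e n)).
Proof. exact: is_cvg_seriesD. Qed.

(** The action of [mxR00] on sequences. *)
Definition actR00 a : R^nat := fun n => a n + (if n is m.+1 then a m else 0).
(** The action of [mxS00] on sequences. *)
Definition actS00 c : R^nat := fun n =>
  n.+1%:R / (2 * n + 1)%:R * c n - n.+1%:R / (2 * n.+1 + 1)%:R * c n.+1.

Lemma actR00_sum a L N :
  \sum_(0 <= n < N) a n * (L n.+1 + L n) =
  \sum_(0 <= n < N.+1) actR00 a n * L n - a N * L N.
Proof.
elim: N => [|N IH].
  by rewrite big_geq// big_nat1 /actR00 addr0 subrr.
by rewrite big_nat_recr//= IH [in RHS]big_nat_recr//= /actR00; ring.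
Qed.

Lemma actS00_sum c L g N :
  (forall n, (2 * n + 1)%:R * L n = n.+1%:R * g n - n%:R * g n.-1) ->
  \sum_(0 <= n < N.+1) c n * L n =
  \sum_(0 <= n < N) actS00 c n * g n + c N * (N.+1%:R / (2 * N + 1)%:R * g N).
Proof.
move=> hL.
have d0 n : (2 * n + 1)%:R != 0 :> R by rewrite addn1 pnatr_eq0.
have {hL}hL n : L n = n.+1%:R / (2 * n + 1)%:R * g n - n%:R /
  (2 * n + 1)%:R * g n.-1.
  apply: (mulfI (d0 n)); rewrite hL; move: (d0 n).
  by move: (2 * n + 1)%:R => e e0; field.
elim: N => [|N IH].
  by rewrite big_nat1 big_geq// hL mul0r mul0r subr0 add0r.
rewrite big_nat_recr//= IH [in RHS]big_nat_recr//= hL /actS00/=.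
ring.
Qed.

(** Summation by parts, once for each factor. The boundary terms are controlled by
    [(n + 1) |a n|], which tends to [0] as the term of a convergent series. *)
Lemma actS00R00_series a L g C :
  (forall n, (2 * n + 1)%:R * L n = n.+1%:R * g n - n%:R * g n.-1) ->
  (forall n, `|L n| <= C) -> (forall n, `|g n| <= C * n.+1%:R) ->
  cvgn (series (fun n => `|a n| * n.+1%:R)) ->
  limn (series (fun n => a n * (L n.+1 + L n))) =
  limn (series (fun n => actS00 (actR00 a) n * g n)).
Proof.
move=> hL LC gC ca.
have C0 : 0 <= C by apply: le_trans (LC 0%N).
have cLHS : cvgn (series (fun n => a n * (L n.+1 + L n))).
  apply: (@series_dom_cvg _ (fun n => 2 * C * (`|a n| * n.+1%:R)));
    last exact: cvg_seriesZ.
  move=> n; rewrite normrM.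
  have h : `|L n.+1 + L n| <= 2 * C.
    by rewrite (le_trans (ler_normD _ _))// mulr_natl mulr2n lerD.
  rewrite mulrCA ler_wpM2l//; apply: (le_trans h); rewrite ler_peMr ?mulr_ge0//.
  by rewrite ler1n.
(* The boundary terms of [actR00_sum] and [actS00_sum]. *)
pose r n := a n * L n - actR00 a n * (n.+1%:R / (2 * n + 1)%:R * g n).
have e n : series (fun n => actS00 (actR00 a) n * g n) n =
    series (fun n => a n * (L n.+1 + L n)) n + r n.
  by rewrite /series/= actR00_sum (actS00_sum _ _ hL) /r; ring.
have rcv : r @ \oo --> 0.
  have a0 := cvg_series_cvg_0 ca.
  have a1 := cvg_series_cvg_0 (cvg_series_unshift ca).
  pose s n := 2 * C * (`|a n| * n.+1%:R) +
    2 * C * (if n is m.+1 then `|a m| * m.+1%:R else 0).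
  have s0 : s @ \oo --> 0.
    have -> : 0 = 2 * C * 0 + 2 * C * 0 :> R by ring.
    by apply: cvgD; apply: cvgM => //; exact: cvg_cst.
  have rs n : `|r n| <= s n.
    apply: (le_trans (ler_normB _ _)).
    have h1 : `|a n * L n| <= C * (`|a n| * n.+1%:R).
      rewrite normrM mulrCA ler_wpM2l//; apply: (le_trans (LC n)).
      by rewrite ler_peMr// ler1n.
    have h2 : `|n.+1%:R / (2 * n + 1)%:R * g n| <= C * n.+1%:R.
      rewrite normrM; apply: (le_trans _ (gC n)); rewrite ler_piMl//.
      rewrite ger0_norm ?divr_ge0// ler_pdivrMr ?mul1r ?ltr0n ?addn1// ler_nat ltnS.
      by rewrite leq_pmull.
    have h3 : `|actR00 a n| <= `|a n| + (if n is m.+1 then `|a m| else 0).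
      rewrite /actR00; apply: (le_trans (ler_normD _ _)).
      by case: (n) => [|m]; rewrite ?normr0.
    have h4 : `|actR00 a n * (n.+1%:R / (2 * n + 1)%:R * g n)| <=
        (`|a n| + (if n is m.+1 then `|a m| else 0)) * (C * n.+1%:R).
      by rewrite normrM ler_pM.
    apply: (le_trans (lerD h1 h4)); rewrite /s mulrDl.
    have h5 : (if n is m.+1 then `|a m| else 0) * (C * n.+1%:R) <=
        2 * C * (if n is m.+1 then `|a m| * m.+1%:R else 0).
      case: (n) => [|m]; first by rewrite mul0r mulr0.
      have -> : 2 * C * (`|a m| * m.+1%:R) = `|a m| * (C * (2 * m.+1%:R)) by ring.
      rewrite ler_wpM2l// ler_wpM2l// -natrM ler_nat.
      by rewrite mul2n -addnn addSn ltnS leq_addl.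
    by apply: le_trans (lerD (lexx _) (lerD (lexx _) h5)) _; lra.
  have ns0 : (fun n => - s n) @ \oo --> 0 by rewrite -oppr0; exact: cvgN.
  apply: (squeeze_cvgr _ ns0 s0); near=> n.
  by rewrite -ler_norml.
have -> : series (fun n => actS00 (actR00 a) n * g n) =
  series (fun n => a n * (L n.+1 + L n)) + r.
  by apply/funext.
rewrite limD//; last by apply/cvg_ex; exists 0.
by rewrite (cvg_lim _ rcv)// addr0.
Unshelve. all: by end_near. Qed.

End series.

(** * One step of the root matrix on real sequences *)

Section frac_term.
Context {R : realType}.
Implicit Types (nu b m x y t : R) (v : R^nat).

Definition wsummable b v := cvgn (series (fun n => `|v n| * jac_norm b n)).

Definition frac_term nu b y v : R :=
  limn (series (fun n => v n * frac_poly nu b y (jac b n))).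

Definition gscale m b v : R^nat := fun n => gratio m b n * v n.

Lemma frac_term_gscale nu m b y v : 0 <= b -> 0 <= m ->
  frac_term (nu + m) b y v = frac_term nu (b + m) y (gscale m b v).
Proof.
move=> b0 m0; rewrite /frac_term; congr (limn (series _)); apply/funext => n.
by rewrite frac_poly_jac// /gscale; rewrite mulrA (mulrC (v n)).
Qed.

Lemma wsummable_gscale m b v : 0 <= b -> 0 < m -> wsummable b v ->
  wsummable (b + m) (gscale m b v).
Proof.
move=> b0 m0 h.
apply: (@series_dom_cvg _ _ (fun n => gratio m b 0 * (`|v n| * jac_norm b n)));
  last exact: cvg_seriesZ.
move=> n; have g0 := gratio_ge0 n (ltW m0) b0.
rewrite normrM normr_id (ger0_norm (jac_norm_ge0 _ _)) /gscale (normrM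
  (gratio _ _ _)) (ger0_norm g0).
rewrite mulrAC (mulrC (`|v n|)) mulrA; apply: ler_wpM2r => //.
exact: gratio_jac_norm.
Qed.

Lemma cvg_gscale_corner m b v : 0 <= b -> 0 < m -> b + m = 1 -> wsummable b v ->
  cvgn (series (fun n => `|gscale m b v n| * n.+1%:R)).
Proof.
move=> b0 m0 bm h.
apply: (@series_dom_cvg _ _ (fun n => Gamma (b + 1) * (`|v n| * jac_norm b n)));
  last exact: cvg_seriesZ.
move=> n; have g0 := gratio_ge0 n (ltW m0) b0.
rewrite normrM normr_id normr_nat /gscale (normrM (gratio _ _ _)) (ger0_norm g0).
rewrite mulrAC (mulrC (`|v n|)) mulrA; apply: ler_wpM2r => //.
exact: gratio_corner.
Qed.

(** After [frac_term_gscale] the exponent is [b + m = 1], that is, the polynomial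
    is multiplied by [1 + x]; the relations between [jac 1], [leg] and [jac 0] are
    preserved by [frac_poly nu], which is linear. *)
Lemma frac_term_corner nu m b x v : 0 <= nu -> 0 <= b -> 0 < m -> b + m = 1 ->
  -1 < x <= 1 -> wsummable b v ->
  frac_term (nu + m) b (1 + x) v =
  frac_term nu 0 (1 + x) (actS00 (actR00 (gscale m b v))).
Proof.
move=> nu0 b0 m0 bm /andP[x1 x2] h.
rewrite (frac_term_gscale _ _ _ b0 (ltW m0)) bm /frac_term.
pose L n := frac_poly nu 0 (1 + x) (leg n).
pose g n := frac_poly nu 0 (1 + x) (jac 0 n).
rewrite -(@actS00R00_series _ (gscale m b v) L g (frac_poly nu 0 (1 + x) 1)).
- congr (limn (series _)); apply/funext => n; congr (_ * _).
  by have := frac_polyMX nu 0 (1 + x) (jac 1 n);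
    rewrite mulX_jac1 frac_polyD add0r => <-.
- move=> n; have := congr1 (frac_poly nu 0 (1 + x)) (leg_jac0 n).
  by rewrite -scaleNr frac_polyD !frac_polyZ mulNr.
- move=> n; rewrite -[leRHS]mul1r; apply: frac_poly_le => // t /andP[t1 t2].
  by apply: leg_le1; rewrite t1 (le_trans t2).
- move=> n; rewrite mulrC; apply: frac_poly_le => // t /andP[t1 t2].
  by apply: jac0_le; rewrite t1 (le_trans t2).
- exact: cvg_gscale_corner.
Qed.

(** Entry [n] of the image involves the entries [n - 1], [n] and [n + 1] of the
    scaled sequence with bounded coefficients, and [jac_norm 0 n <= n + 1]; hence
    the series is dominated by shifts of the one in [cvg_gscale_corner]. *)
Lemma wsummable_corner m b v : 0 <= b -> 0 < m -> b + m = 1 -> wsummable b v ->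
  wsummable 0 (actS00 (actR00 (gscale m b v))).
Proof.
move=> b0 m0 bm h; have ca := cvg_gscale_corner b0 m0 bm h.
set a := gscale m b v in ca *; pose d n := `|a n| * n.+1%:R.
pose e n := 2 * d n + 2 * (if n is k.+1 then d k else 0) + d n.+1.
apply: (@series_dom_cvg _ _ e); last first.
  apply: cvg_seriesD; last exact: (cvg_series_shift ca).
  apply: cvg_seriesD; first exact: cvg_seriesZ.
  by apply: cvg_seriesZ; exact: (cvg_series_unshift ca).
move=> n; rewrite normrM normr_id (ger0_norm (jac_norm_ge0 _ _)).
apply: (@le_trans _ _ ((`|actR00 a n| + `|actR00 a n.+1|) * n.+1%:R)).
  apply: ler_pM => //; [exact: jac_norm_ge0| |exact: jac_norm0_le].
  rewrite /actS00; apply: (le_trans (ler_normB _ _)); rewrite !(normrM (_ / _)).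
  apply: lerD; apply: ler_piMl => //; rewrite ger0_norm ?divr_ge0//.
    rewrite ler_pdivrMr ?mul1r ?ltr0n ?addn1// ler_nat ltnS.
    by rewrite leq_pmull.
  rewrite ler_pdivrMr ?mul1r ?ltr0n ?addn1// ler_nat ltnS.
  by rewrite mul2n -addnn addSn (leq_trans (leq_addr n.+1 n))// leqnSn.
have R1 : `|actR00 a n.+1| <= `|a n.+1| + `|a n| by rewrite /actR00;
  exact: ler_normD.
have R0 : `|actR00 a n| <= `|a n| + (if n is k.+1 then `|a k| else 0).
  rewrite /actR00; apply: (le_trans (ler_normD _ _)).
  by case: (n) => [|k]; rewrite ?normr0.
have h1 : (if n is k.+1 then `|a k| else 0) * n.+1%:R <= 2 * (if n is k.+1 then
  d k else 0).
  case: (n) => [|k]; first by rewrite mul0r mulr0.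
  rewrite /d mulrCA ler_wpM2l// -natrM ler_nat.
  by rewrite mul2n -addnn addSn ltnS leq_addl.
have h2 : `|a n.+1| * n.+1%:R <= d n.+1 by rewrite /d ler_wpM2l// ler_nat.
apply: (@le_trans _ _ ((`|a n| + (if n is k.+1 then
  `|a k| else 0) + (`|a n.+1| + `|a n|)) * n.+1%:R)).
  by rewrite ler_wpM2r// lerD.
rewrite /e !mulrDl; apply: (@le_trans _ _ (d n + 2 * (if n is k.+1 then
  d k else 0) + (d n.+1 + d n))).
  by apply: lerD; apply: lerD.
by rewrite le_eqVlt; apply/orP; left; apply/eqP; ring.
Qed.

End frac_term.

Section step.
Context {R : realType} (q : nat) (q0 : (0 < q)%N).
Implicit Types (v : 'I_q -> R^nat) (nu x : R).

Definition expo k : R := k%:R / q%:R.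

Definition scaled_block v (k : 'I_q) : R^nat := gscale q%:R^-1 (expo k) (v k).

(** The action of [Qroot] on real sequences. Its nonzero blocks are those with
    [j = k + 1] modulo [q], so block [j] of the image depends on the cyclic
    predecessor of [j] only; see [part_Qroot]. *)
Definition root_act v (j : 'I_q) : R^nat :=
  let a := scaled_block v (ord_pred j) in
  if j == 0%N :> nat then actS00 (actR00 a) else a.

Definition real_in_Pq v := forall k : 'I_q, wsummable (expo k) (v k).

(** The fractional integral of order [nu] of the expansion, term by term. *)
Definition frac_series nu y v : R :=
  \sum_(k : 'I_q) frac_term nu (expo k) y (v k).

Lemma expo0 : expo 0 = 0.
Proof. exact: mul0r. Qed.

Lemma expo_ge0 k : 0 <= expo k.
Proof. by rewrite divr_ge0. Qed.

Lemma invq_gt0 : 0 < q%:R^-1 :> R.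
Proof. by rewrite invr_gt0 ltr0n. Qed.

Lemma expoS (k : nat) : expo k + q%:R^-1 = expo k.+1.
Proof. by rewrite /expo -natr1 mulrDl mul1r. Qed.

Lemma expo_last (k : nat) : k.+1 = q -> expo k + q%:R^-1 = 1.
Proof. by move=> kq; rewrite expoS /expo kq divff// pnatr_eq0 -lt0n. Qed.

Lemma ordS_cases (k : 'I_q) :
  (k.+1 = q /\ ordS k = 0%N :> nat) \/ (ordS k = k.+1 :> nat).
Proof.
have [kq|kq|kq] := ltngtP k.+1 q.
- by right; rewrite /= modn_small.
- by have := ltn_ord k; rewrite ltnNge -ltnS kq.
- by left; rewrite /= kq modnn.
Qed.

Lemma root_act_ordS v k : root_act v (ordS k) =
  if ordS k == 0%N :> nat then actS00 (actR00 (scaled_block v k))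
  else scaled_block v k.
Proof. by rewrite /root_act ordSK. Qed.

Lemma real_in_Pq_root_act v : real_in_Pq v -> real_in_Pq (root_act v).
Proof.
move=> hv j; rewrite -(ord_predK j); set k := ord_pred j.
rewrite root_act_ordS /scaled_block.
have [[kq e]|e] := ordS_cases k; rewrite e.
  rewrite eqxx expo0; apply: wsummable_corner => //.
  - exact: expo_ge0.
  - exact: invq_gt0.
  - exact: expo_last.
rewrite -expoS; apply: wsummable_gscale => //.
- exact: expo_ge0.
- exact: invq_gt0.
Qed.

Lemma frac_series_root_act nu x v : 0 <= nu -> -1 < x <= 1 -> real_in_Pq v ->
  frac_series (nu + q%:R^-1) (1 + x) v = frac_series nu (1 + x) (root_act v).
Proof.
move=> nu0 x1 hv; rewrite /frac_series [RHS](reindex_inj (can_inj (@ordSK q))).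
apply: eq_big => // k _; rewrite root_act_ordS /scaled_block.
have [[kq e]|e] := ordS_cases k; rewrite e.
  rewrite eqxx expo0; apply: frac_term_corner => //.
  - exact: expo_ge0.
  - exact: invq_gt0.
  - exact: expo_last.
rewrite -expoS; apply: frac_term_gscale.
- exact: expo_ge0.
- exact/ltW/invq_gt0.
Qed.

Lemma real_in_Pq_iter p v : real_in_Pq v -> real_in_Pq (iter p root_act v).
Proof. by move=> hv; elim: p => //= p; exact: real_in_Pq_root_act. Qed.

(** The order decreases by [1 / q] with each application of the matrix, down to
    order [0]. *)
Lemma frac_series_iter p x v : -1 < x <= 1 -> real_in_Pq v ->
  frac_series (expo p) (1 + x) v = frac_series 0 (1 + x) (iter p root_act v).
Proof.
move=> x1; elim: p v => [v _|p IH v hv]; first by rewrite expo0.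
rewrite -(expoS p) frac_series_root_act ?expo_ge0//.
by rewrite IH ?iterSr//; exact: real_in_Pq_root_act.
Qed.

End step.

(** * Fractional integration term by term *)

Section termwise.
Context {R : realType}.
Local Notation mu := (@lebesgue_measure R).
Implicit Types (nu b m x y t : R) (v : R^nat).

Definition jac_series b v t : R := limn (series (fun n => v n * (jac b n).[1 + t])).

Lemma cvg_jac_series b v t : -1 <= t <= 1 -> wsummable b v ->
  cvgn (series (fun n => v n * (jac b n).[1 + t])).
Proof.
move=> t1 h; apply: (series_dom_cvg _ h) => n.
by rewrite normrM ler_wpM2l// jac_norm_ub.
Qed.

(** Dominated convergence: the partial sums are bounded by the sum of the
    [|v n| jac_norm b n], so the integrands are bounded by a multiple of the
    integrable weight. *)
Lemma Rintegral_jac_series nu b x v : 0 < nu -> 0 <= b -> -1 < x <= 1 ->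
  wsummable b v ->
  mu.-integrable `]-1, x[
    (EFin \o (fun t => jac_series b v t * frac_weight nu b x t)) /\
  \int[mu]_(t in `]-1, x[) (jac_series b v t * frac_weight nu b x t) =
    Gamma nu * frac_term nu b (1 + x) v.
Proof.
move=> nu0 b0 /andP[x1 x2] h.
pose S N : {poly R} := \sum_(n < N) v n *: jac b n.
pose W := frac_weight nu b x.
pose f_ N (t : R) := ((S N).[1 + t] * W t)%:E.
pose f (t : R) := (jac_series b v t * W t)%:E.
pose M := limn (series (fun n => `|v n| * jac_norm b n)).
have SE N t : (S N).[1 + t] = series (fun n => v n * (jac b n).[1 + t]) N.
  rewrite /series/= horner_sum big_mkord; apply: eq_bigr => i _.
  by rewrite hornerZ.
have mS N (D : set R) : measurable_fun D (fun t : R => (S N).[1 + t]).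
  apply: measurable_funTS; apply: (measurableT_comp (f := fun s : R => (S N).[s])).
    apply: continuous_measurable_fun => s; exact: continuous_horner.
  exact: measurable_funD.
have mW (D : set R) : measurable_fun D W by exact: measurable_frac_weight.
have mf_ N : measurable_fun `]-1, x[ (f_ N).
  by apply/measurable_EFinP; apply: measurable_funM.
have Sf t : `]-1, x[%classic t -> f_ ^~ t @ \oo --> f t.
  rewrite /= in_itv/= => /andP[t1 t2].
  apply: cvg_EFin; first by near=> n.
  apply: cvgM; last exact: cvg_cst.
  rewrite /comp/=; under eq_fun do rewrite SE.
  apply: cvg_jac_series => //; lra.
have mf : measurable_fun `]-1, x[ f.
  by apply: (emeasurable_fun_cvg f_).
have iW : mu.-integrable `]-1, x[ (EFin \o (fun t => M * W t)).
  by apply: integrableZl_EFin => //; exact: integrable_frac_weight.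
have fM t N : `]-1, x[%classic t -> (`|f_ N t| <= (M * W t)%:E)%E.
  rewrite /= in_itv/= => /andP[t1 t2].
  rewrite lee_fin normrM (ger0_norm (frac_weight_ge0 _ _ _ _)).
  rewrite ler_wpM2r ?frac_weight_ge0// SE.
  apply: (@le_trans _ _ (series (fun n => `|v n| * jac_norm b n) N)).
    rewrite /series/=; apply: (le_trans (ler_norm_sum _ _ _)).
    apply: ler_sum => n _; rewrite normrM ler_wpM2l// jac_norm_ub//; lra.
  apply: nondecreasing_cvgn_le => //.
  apply/nondecreasing_seqP => n; rewrite seriesSr lerDl mulr_ge0//.
  exact: jac_norm_ge0.
have aeS : {ae mu, forall t, `]-1, x[%classic t -> f_ ^~ t @ \oo --> f t}.
  by apply: aeW => t; exact: Sf.
have aeM : {ae mu, forall t N, `]-1, x[%classic t -> (`|f_ N t| <= (M * W t)%:E)%E}.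
  by apply: aeW => t N; exact: fM.
have [If _ cvgI] := @dominated_convergence _ _ _ mu _ (measurable_itv _) f_ f _
   mf_ mf aeS iW aeM.
split; first exact: If.
have cT : cvgn (series (fun n => v n * frac_poly nu b (1 + x) (jac b n))).
  pose C := frac_poly nu b (1 + x) 1.
  apply: (@series_dom_cvg _ _ (fun n => C * (`|v n| * jac_norm b n)));
    last exact: cvg_seriesZ.
  move=> n; rewrite normrM mulrCA ler_wpM2l// mulrC.
  apply: frac_poly_le_gt0 => // t /andP[t1 t2]; apply: jac_norm_ub.
  by rewrite t1 (le_trans t2).
have IS N : (\int[mu]_(t in `](-1)%R, x[) f_ N t =
    (Gamma nu * series (fun n => v n * frac_poly nu b (1 + x) (jac b n)) N)%:E)%E.
  have [IN EN] := frac_poly_integral (S N) nu0 b0 x1.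
  have -> : series (fun n => v n * frac_poly nu b (1 + x) (jac b n)) N =
      frac_poly nu b (1 + x) (S N).
    rewrite /series/= big_mkord /S.
    (* Linearity of [frac_poly], for a finite sum. *)
    apply: (big_ind2 (fun s p => s = frac_poly nu b (1 + x) p)).
    - by rewrite /frac_poly size_poly0 big_ord0.
    - by move=> s1 p1 s2 p2 -> ->; rewrite frac_polyD.
    - by move=> n _; rewrite frac_polyZ.
  rewrite -EN /Rintegral fineK//.
  exact: integrable_fin_num.
(* The integrals of the partial sums converge to both sides. *)
have cG : (\int[mu]_(t in `](-1)%R, x[) f_ N t)%E @[N --> \oo] -->
    (Gamma nu * frac_term nu b (1 + x) v)%:E.
  under eq_fun do rewrite IS.
  apply: cvg_EFin; first by near=> n.
  by apply: cvgM => //; exact: cvg_cst.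
have e := cvg_unique _ cvgI cG.
by rewrite /Rintegral [X in fine X]e.
Unshelve. all: by end_near. Qed.

End termwise.

(** * Banded matrices *)

Lemma lim_series_fin (K : numFieldType) (V : normedModType K) (f : nat -> V) N :
  (forall l, (N <= l)%N -> f l = 0) -> limn (series f) = \sum_(l < N) f l.
Proof.
move=> f0; apply: lim_near_cst; first exact: norm_hausdorff.
exists N => // n /= Nn; rewrite /series/= (@big_cat_nat _ _ _ N)//=.
rewrite [X in _ + X]big_nat_cond [X in _ + X]big1 ?addr0 ?big_mkord//.
by move=> i /andP[/andP[Ni _] _]; exact: f0.
Qed.

Section banded.
Local Open Scope complex_scope.
Context {R : realType}.
Implicit Types (A B : infmx R) (u : nat -> R[i]) (m i j n N : nat).

(** [banded] with an explicit bandwidth, so that the infinite sums in products and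
    actions can be truncated at a known index. *)
Definition band m A := forall i j, ((i + m < j) || (j + m < i))%N -> A i j = 0.

Lemma band_widen m n A : (m <= n)%N -> band m A -> band n A.
Proof.
move=> mn h i j /orP[]ij; apply: h; apply/orP; [left|right];
  by apply: leq_ltn_trans ij; rewrite leq_add2l.
Qed.

Lemma infmx_mulE m A B i j N : band m A -> (i + m < N)%N ->
  infmx_mul A B i j = \sum_(l < N) A i l * B l j.
Proof.
move=> hA iN; apply: (@lim_series_fin R (R^o) (fun l => A i l * B l j)) => l Nl.
by rewrite hA ?mul0r// (leq_trans iN).
Qed.

Lemma infmx_actE m A u i N : band m A -> (i + m < N)%N ->
  infmx_act A u i = \sum_(j < N) (A i j)%:C * u j.
Proof.
move=> hA iN; rewrite /infmx_act.
apply: (@lim_series_fin R[i] (R[i]^o) (fun j => (A i j)%:C * u j)) => j Nj.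
by rewrite hA ?mul0r// (leq_trans iN).
Qed.

Lemma band_mul m n A B : band m A -> band n B -> band (m + n) (infmx_mul A B).
Proof.
move=> hA hB i j ij; rewrite (infmx_mulE B j hA (ltnSn _)) big1// => l _.
have [h|h] := boolP ((i + m < l) || (l + m < i))%N; first by rewrite hA ?mul0r.
rewrite hB ?mulr0//; move: h ij; rewrite negb_or -!leqNgt => /andP[h1 h2] /orP[h|h].
  apply/orP; left; rewrite (leq_trans _ h)// ltnS addnA; lia.
apply/orP; right; lia.
Qed.

Lemma infmx_act_mul m n A B u i : band m A -> band n B ->
  infmx_act (infmx_mul A B) u i = infmx_act A (infmx_act B u) i.
Proof.
move=> hA hB; pose N := (i + m).+1; pose N' := (N + n)%N.
rewrite (@infmx_actE (m + n) _ _ _ N'); [|exact: band_mul|rewrite /N' /N; lia].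
rewrite (infmx_actE _ hA (ltnSn _)).
under eq_bigr => j _.
  rewrite (infmx_mulE B j hA (ltnSn _)) raddf_sum mulr_suml; over.
rewrite exchange_big/=; apply: eq_bigr => l _.
rewrite (infmx_actE (N := N') _ hB) ?mulr_sumr; last by rewrite /N' ltn_add2r.
by apply: eq_bigr => j _; rewrite rmorphM mulrA.
Qed.

End banded.

Section block.
Local Open Scope complex_scope.
Context {R : realType} (q : nat).
Implicit Types (A B : blockmx R q) (u : 'I_q -> nat -> R[i]) (m n : nat).

Definition block_band m A := forall j k, band m (A j k).

(** There are finitely many blocks, hence a common bandwidth. *)
Lemma block_bandedP A : block_banded A <-> exists m, block_band m A.
Proof.
split=> [h|[m h] j k]; last by exists m; exact: h.
pose P (x : 'I_q * 'I_q) m := band m (A x.1 x.2).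
have {h}h x : {m | P x m} by apply: cid; exact: h.
exists (\max_x sval (h x)) => j k.
apply: (band_widen (leq_bigmax (j, k))); exact: (svalP (h (j, k))).
Qed.

Lemma block_band_mul m n A B : block_band m A -> block_band n B ->
  block_band (m + n) (blockmx_mul A B).
Proof.
move=> hA hB j k i i' ii; rewrite mxE big1// => l _.
exact: (band_mul (hA j l) (hB l k)).
Qed.

Lemma block_band_one m : block_band m (blockmx_one R q).
Proof.
move=> j k i i' ii; rewrite mxE; have [e|] := eqVneq i i'; last by rewrite andbF.
by move: ii; rewrite e !ltnNge leq_addr.
Qed.

Lemma blockmx_actE m A u j i N : block_band m A -> (i + m < N)%N ->
  blockmx_act A u j i = \sum_k \sum_(l < N) (A j k i l)%:C * u k l.
Proof.
by move=> hA iN; apply: eq_bigr => k _; rewrite (infmx_actE _ (hA j k) iN).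
Qed.

Lemma blockmx_act_mul m n A B u : block_band m A -> block_band n B ->
  blockmx_act (blockmx_mul A B) u = blockmx_act A (blockmx_act B u).
Proof.
move=> hA hB; apply/funext => j; apply/funext => i.
pose N := (i + m).+1; pose N' := (N + n)%N.
rewrite (@blockmx_actE (m + n) _ _ _ _ N'); [|exact: block_band_mul|rewrite /N' /N;
  lia].
rewrite (blockmx_actE _ _ hA (ltnSn _)).
transitivity (\sum_k \sum_(l < N') \sum_h \sum_(l' < N)
   (A j h i l')%:C * ((B h k l' l)%:C * u k l)).
  apply: eq_bigr => k _; apply: eq_bigr => l _; rewrite mxE raddf_sum mulr_suml.
  apply: eq_bigr => h _; rewrite (infmx_mulE _ _ (hA j h)
    (ltnSn _)) raddf_sum mulr_suml.
  by apply: eq_bigr => l' _; rewrite /= rmorphM mulrA.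
under eq_bigr do rewrite exchange_big/=.
rewrite exchange_big/=; apply: eq_bigr => h _.
under eq_bigr do rewrite exchange_big/=.
rewrite exchange_big/=; apply: eq_bigr => l' _.
rewrite (blockmx_actE (N := N') _ _ hB) ?mulr_sumr; last by rewrite /N' ltn_add2r.
by apply: eq_bigr => k _; rewrite mulr_sumr.
Qed.

Lemma blockmx_act_one u : blockmx_act (blockmx_one R q) u = u.
Proof.
apply/funext => j; apply/funext => i.
rewrite (blockmx_actE _ _ (block_band_one (m := 0)) (ltnSn _)) (bigD1 j)//=.
rewrite [X in _ + X]big1 ?addr0 => [|k kj]; last first.
  by apply: big1 => l _; rewrite mxE eq_sym (negbTE kj) mul0r.
rewrite addn0 big_ord_recr/= big1 ?add0r => [|l _]; last first.
  by rewrite mxE (gtn_eqF (ltn_ord l)) andbF mul0r.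
by rewrite mxE !eqxx mul1r.
Qed.

Lemma block_banded_exp p A : block_banded A -> block_banded (blockmx_exp A p).
Proof.
move=> /block_bandedP[m hA]; apply/block_bandedP.
elim: p => [|p [n IH]]; first by exists 0%N; exact: block_band_one.
by exists (m + n)%N; exact: block_band_mul.
Qed.

Lemma blockmx_act_exp p A u : block_banded A ->
  blockmx_act (blockmx_exp A p) u = iter p (blockmx_act A) u.
Proof.
move=> hA; elim: p => [|p IH]; first exact: blockmx_act_one.
have /block_bandedP[n hp] := block_banded_exp p hA.
move/block_bandedP: hA => [m hA].
by rewrite iterS -IH -(blockmx_act_mul u hA hp).
Qed.

End block.

(** * The action of the root matrix *)

Section root_blocks.
Local Open Scope complex_scope.
Context {R : realType}.
Implicit Types (u : nat -> R[i]) (n : nat).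

Lemma band_diagQ (m b : R) : band 0 (diagQ m b).
Proof. by move=> i j; rewrite !addn0 -neq_ltn /diagQ => /negbTE ->. Qed.

Lemma band_R00 : band 1 (mxR00 R).
Proof.
move=> i j h; rewrite /mxR00; have -> : ((i == j) || (i == j.+1)) = false => //.
by apply/negbTE; move: h; rewrite negb_or; lia.
Qed.

Lemma band_S00 : band 1 (mxS00 R).
Proof.
move=> i j h; rewrite /mxS00.
have -> : (i == j) = false by apply/eqP; lia.
by have -> : (i.+1 == j) = false by apply/eqP; lia.
Qed.

Section part.
Variable rho : {additive R[i] -> R}.
Hypothesis rhoZ : forall (r : R) z, rho (r%:C * z) = r * rho z.

Lemma part_diagQ m b u n :
  rho (infmx_act (diagQ m b) u n) = gscale m b (fun k => rho (u k)) n.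
Proof.
rewrite (infmx_actE _ (band_diagQ m b) (ltnSn _)) addn0 big_ord_recr/= big1 ?add0r.
  by rewrite /diagQ eqxx rhoZ.
by move=> i _; rewrite /diagQ gtn_eqF ?mul0r.
Qed.

Lemma part_R00 u n : rho (infmx_act (mxR00 R) u n) = actR00 (fun k => rho (u k)) n.
Proof.
have e1 : (n == n.+1) = false by rewrite ltn_eqF.
have e2 : (n == n.+2) = false by rewrite ltn_eqF// ltnS ltnW.
rewrite (infmx_actE _ band_R00 (ltnSn _)) addn1 big_ord_recr/= /mxR00 e1 e2.
rewrite mul0r addr0 big_ord_recr/= eqxx mul1r raddfD /actR00 addrC; congr (_ + _).
case: n {e1 e2} => [|n]; first by rewrite big_ord0 raddf0.
rewrite big_ord_recr/= eqxx orbT mul1r big1 ?add0r// => i _.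
have hi := ltn_ord i.
by rewrite (gtn_eqF (ltnW hi : i < n.+1)%N) eqSS (gtn_eqF hi) mul0r.
Qed.

Lemma part_S00 u n : rho (infmx_act (mxS00 R) u n) = actS00 (fun k => rho (u k)) n.
Proof.
rewrite (infmx_actE _ band_S00 (ltnSn _)) addn1 !big_ord_recr/= /mxS00.
rewrite big1 ?add0r => [|i _]; last first.
  have hi := ltn_ord i.
  by rewrite (gtn_eqF hi) (gtn_eqF (ltnW hi : i < n.+1)%N) mul0r.
rewrite !eqxx (ltn_eqF (ltnSn n)).
by rewrite raddfD/= !rhoZ mulNr.
Qed.

End part.
End root_blocks.

Section root_matrix.
Local Open Scope complex_scope.
Context {R : realType} (q : nat) (q0 : (0 < q)%N).
Variable rho : {additive R[i] -> R}.
Hypothesis rhoZ : forall (r : R) z, rho (r%:C * z) = r * rho z.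
Implicit Types (u : 'I_q -> nat -> R[i]).

Lemma block_band_Qroot : block_band 2 (Qroot R q).
Proof.
move=> j k; rewrite mxE; case: ifP => _.
  by apply: (band_widen (m := 0)) => //; exact: band_diagQ.
case: ifP => _ //.
apply: (band_mul (m := 2) (n := 0)); last exact: band_diagQ.
exact: (band_mul (m := 1) (n := 1)) band_S00 band_R00.
Qed.

Lemma infmx_act0 (w : nat -> R[i]) n : infmx_act (fun _ _ => 0 : R) w n = 0.
Proof.
by rewrite (@infmx_actE _ 0 _ _ _ n.+1) ?addn0// big1// => l _; rewrite mul0r.
Qed.

(** Stated for an additive map [rho] that commutes with real scalars, in order to
    treat real and imaginary parts together. *)
Lemma part_Qroot u (j : 'I_q) n :
  rho (blockmx_act (Qroot R q) u j n) = root_act (fun k n => rho (u k n)) j n.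
Proof.
rewrite -(ord_predK j); move: (ord_pred j) => {j} k.
rewrite /blockmx_act (bigD1 k)//= raddfD/= [X in _ + rho X]big1 ?raddf0 ?addr0;
  last first.
  move=> h hk; rewrite mxE.
  have jk : (ordS k == ordS h :> nat) = false.
    by apply/negbTE; apply: contra hk => /eqP/val_inj/(can_inj (@ordSK q)) ->.
  have kq1 : (ordS k == h.+1 :> nat) = false.
    have [[kq _]|e] := ordS_cases h; last by rewrite -e.
    by rewrite kq ltn_eqF.
  have kq2 : (ordS k == 0%N :> nat) && (h.+1 == q) = false.
    apply/negbTE/negP => /andP[/eqP j0 /eqP kq].
    by have := jk; rewrite j0 /= kq modnn.
  by rewrite kq1 kq2 infmx_act0.
rewrite root_act_ordS mxE.
have [[kq e]|e] := ordS_cases k; rewrite e; last first.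
  by rewrite eqxx /=; apply: part_diagQ.
rewrite /= kq !eqxx /=.
have -> : 1 - q%:R^-1 = expo q k :> R by apply/eqP;
  rewrite subr_eq (expo_last q0 kq).
rewrite (@infmx_act_mul _ 2 0); last 2 first.
- exact: (band_mul (m := 1) (n := 1)) band_S00 band_R00.
- exact: band_diagQ.
have -> : infmx_act (infmx_mul (mxS00 R) (mxR00 R)) =
    fun w => infmx_act (mxS00 R) (infmx_act (mxR00 R) w).
  apply/funext => w; apply/funext => i.
  exact: (infmx_act_mul _ _ band_S00 band_R00).
rewrite part_S00//; congr (actS00 _ n); apply/funext => i.
rewrite part_R00//; congr (actR00 _ i); apply/funext => l.
exact: part_diagQ.
Qed.

End root_matrix.

(** * Real and imaginary parts *)

Section parts.
Local Open Scope complex_scope.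
Context {R : realType}.
Local Notation mu := (@lebesgue_measure R).
Implicit Types (z : R[i]).

Definition part (b : bool) : {additive R[i] -> R} :=
  if b then (@complex.Re R : {additive R[i] ->
  R}) else (@complex.Im R : {additive R[i] -> R}).

Lemma partZ b (r : R) z : part b (r%:C * z) = r * part b z.
Proof. by case: b; case: z => x y /=; rewrite mul0r ?subr0 ?addr0. Qed.

Lemma normc_part b z : `|part b z| <= ComplexField.Normc.normc z.
Proof.
case: b z => -[x y] /=; rewrite -sqrtr_sqr; apply: ler_wsqrtr;
  by rewrite ?lerDl ?lerDr sqr_ge0.
Qed.

Lemma normc_le z : ComplexField.Normc.normc z <= `|part true z| + `|part false z|.
Proof.
case: z => x y /=; rewrite -[leRHS]ger0_norm ?addr_ge0// -sqrtr_sqr.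
apply: ler_wsqrtr; rewrite sqrrD !real_normK ?num_real//.
by rewrite addrAC lerDl mulrn_wge0// mulr_ge0.
Qed.

Lemma part_inj z1 z2 : (forall b, part b z1 = part b z2) -> z1 = z2.
Proof.
case: z1 z2 => x1 y1 [x2 y2] h.
by have /= -> := h true; have /= -> := h false.
Qed.

Lemma cvg_parts (f : nat -> R[i]) z :
  (forall b, part b (f n) @[n --> \oo] --> part b z) ->
  (f : nat -> R[i]^o) @ \oo --> (z : R[i]^o).
Proof.
move=> h; apply/cvgrPdist_lt => e e0.
have [ei er] : complex.Im e = 0 /\ 0 < complex.Re e.
  by move: e0; rewrite ltcE => /andP[/eqP -> ->].
have er2 : 0 < complex.Re e / 2 by rewrite divr_gt0.
have /cvgrPdist_lt /(_ _ er2) h1 := h true.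
have /cvgrPdist_lt /(_ _ er2) h2 := h false.
near=> n.
have -> : `|(z : R[i]^o) - f n| = (ComplexField.Normc.normc (z - f n))%:C by [].
rewrite ltcE /= ei eqxx /=; apply: (le_lt_trans (normc_le _)).
rewrite (splitr (complex.Re e)) !raddfB; apply: ltrD.
  by near: n; exact: h1.
by near: n; exact: h2.
Unshelve. all: by end_near. Qed.

Lemma part_limn_series b (f : nat -> R[i]) :
  (forall c, cvgn (series (fun n => part c (f n)))) ->
  part b (limn (series (f : nat -> R[i]^o))) =
  limn (series (fun n => part b (f n))).
Proof.
move=> h; pose l := (limn (series (fun n => part true (f n)))) +i*
  (limn (series (fun n => part false (f n)))).
have pl c : part c l = limn (series (fun n => part c (f n))) by case: c.
have -> : limn (series (f : nat -> R[i]^o)) = l.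
  apply: cvg_lim; first exact: norm_hausdorff.
  apply: cvg_parts => c; rewrite pl.
  have -> : (fun n => part c (series (f : nat -> R[i]^o) n)) =
    series (fun n => part c (f n)).
    by apply/funext => n; rewrite /series/= raddf_sum.
  exact: h.
exact: pl.
Qed.

Lemma part_cintegral b (D : set R) (f : R -> R[i]) :
  part b (cintegral D f) = \int[mu]_(t in D) part b (f t).
Proof. by case: b. Qed.

Lemma cintegrable_parts (D : set R) (f : R -> R[i]) :
  (forall b, mu.-integrable D (EFin \o (fun t => part b (f t)))) -> cintegrable D f.
Proof. by move=> h; split; [exact: (h true)|exact: (h false)]. Qed.

Lemma Rintegral_sum (D : set R) (I : Type) (s : seq I) (f : I -> R -> R) (c : I ->
  R) :
  measurable D ->
  (forall i, mu.-integrable D (EFin \o f i) /\ \int[mu]_(t in D) f i t = c i) ->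
  mu.-integrable D (EFin \o (fun t => \sum_(i <- s) f i t)) /\
  \int[mu]_(t in D) (\sum_(i <- s) f i t) = \sum_(i <- s) c i.
Proof.
move=> mD h; elim: s => [|i s [I1 E1]].
  rewrite big_nil; under [X in _.-integrable _
    (EFin \o X)]eq_fun do rewrite big_nil.
  under eq_Rintegral do rewrite big_nil.
  by split; [exact: integrable0|rewrite Rintegral_cst// mul0r].
have [I2 E2] := h i.
rewrite big_cons; under [X in _.-integrable _
  (EFin \o X)]eq_fun do rewrite big_cons.
under eq_Rintegral do rewrite big_cons.
by split; [exact: integrableD_EFin|rewrite RintegralD// E1 E2].
Qed.

End parts.

Section assembly.
Local Open Scope complex_scope.
Context {R : realType} (q : nat) (q0 : (0 < q)%N).
Local Notation mu := (@lebesgue_measure R).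
Implicit Types (u : 'I_q -> nat -> R[i]) (v : 'I_q -> R^nat) (x t nu : R).

Definition parts b u : 'I_q -> R^nat := fun k n => part b (u k n).

Lemma horner_basisP (k n : nat) x : (basisP R q k n).[x] =
  (jac (expo q k) n).[1 + x].
Proof. by rewrite /basisP horner_jacobi// subrK. Qed.

Lemma sup_basisP (k n : nat) :
  sup [set `|(basisP R q k n).[x]| | x in `[(-1 : R), 1]] = jac_norm (expo q k) n.
Proof. by congr sup; apply: eq_imagel => x _; rewrite horner_basisP. Qed.

(** The norm of a complex number and the sum of the absolute values of its parts
    bound each other up to a constant. *)
Lemma in_PqP u : in_Pq u <-> forall b, real_in_Pq (parts b u).
Proof.
split=> [h b k|h k].
  have := h k; under eq_fun do rewrite sup_basisP.
  apply: series_dom_cvg => n; rewrite normrM normr_id (ger0_norm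
    (jac_norm_ge0 _ _)).
  by rewrite ler_wpM2r ?jac_norm_ge0// normc_part.
under eq_fun do rewrite sup_basisP.
apply: (series_dom_cvg _ (cvg_seriesD (h true k) (h false k))) => n.
rewrite normrM (ger0_norm (jac_norm_ge0 _ _)) -mulrDl ler_wpM2r ?jac_norm_ge0//.
by rewrite ger0_norm ?normc_le//; case: (u k n) => a b; exact: sqrtr_ge0.
Qed.

Lemma part_evalPq b u t : in_Pq u -> -1 <= t <= 1 ->
  part b (evalPq t u) =
  \sum_(k < q) (1 + t) `^ (expo q k) * jac_series (expo q k) (parts b u k) t.
Proof.
move=> /in_PqP hu t1; rewrite /evalPq raddf_sum; apply: eq_bigr => k _.
rewrite partZ; congr (_ * _).
have e c : (fun n => part c (u k n * ((basisP R q k n).[t])%:C)) =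
    (fun n => parts c u k n * (jac (expo q k) n).[1 + t]).
  by apply/funext => n; rewrite mulrC partZ horner_basisP mulrC.
rewrite part_limn_series; first by rewrite e.
by move=> c; rewrite e; apply: cvg_jac_series => //; exact: hu.
Qed.

Lemma part_evalPq_frac b u x : in_Pq u -> -1 < x <= 1 ->
  part b (evalPq x u) = frac_series 0 (1 + x) (parts b u).
Proof.
move=> hu /andP[x1 x2]; rewrite part_evalPq//; last by rewrite ltW.
have y0 : 0 < 1 + x by lra.
apply: eq_bigr => k _; rewrite /frac_term /jac_series.
have hk := (in_PqP u).1 hu b k.
have cs : cvgn (series (fun n => parts b u k n * (jac (expo q k) n).[1 + x])).
  by apply: cvg_jac_series => //; rewrite ltW.
rewrite -[LHS](lim_seriesZ _ cs); congr (limn (series _)); apply/funext => n /=.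
by rewrite frac_poly0 ?expo_ge0// mulrCA.
Qed.

Lemma part_frac_integrand b nu u x t : in_Pq u -> x <= 1 -> -1 < t < x ->
  part b (frac_integrand nu (fun t => evalPq t u) x t) =
  \sum_(k < q) jac_series (expo q k) (parts b u k) t * frac_weight nu
  (expo q k) x t.
Proof.
move=> hu x2 /andP[t1 t2]; rewrite /frac_integrand -fmorphV mulrC partZ.
rewrite part_evalPq//; last by apply/andP; split; lra.
rewrite -powRN opprB mulr_sumr; apply: eq_bigr => k _.
rewrite /frac_weight; move: (_ `^ _) (_ `^ _) => ? ?; ring.
Qed.

Lemma Rintegral_frac_integrand b nu u x : 0 < nu -> in_Pq u -> -1 < x <= 1 ->
  mu.-integrable `]-1, x[
    (EFin \o (fun t => part b (frac_integrand nu (fun t => evalPq t u) x t))) /\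
  \int[mu]_(t in `]-1, x[) part b (frac_integrand nu (fun t => evalPq t u) x t) =
  Gamma nu * frac_series nu (1 + x) (parts b u).
Proof.
move=> nu0 hu x1; have /andP[_ x2] := x1.
pose f (k : 'I_q) t := jac_series (expo q k) (parts b u k) t * frac_weight nu
  (expo q k) x t.
have [If Ef] := @Rintegral_sum R `]-1, x[ _ (index_enum 'I_q) f _ (measurable_itv _)
  (fun k => Rintegral_jac_series nu0 (expo_ge0 q k) x1 ((in_PqP u).1 hu b k)).
have e t : t \in `]-1, x[%classic ->
    part b (frac_integrand nu (fun t => evalPq t u) x t) = \sum_k f k t.
  by rewrite inE/= in_itv/= => tx; rewrite part_frac_integrand.
split.
  apply: (eq_integrable_EFin _ _ If) => //.
  by move=> t /e.
rewrite mulr_sumr -Ef; exact: eq_Rintegral.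
Qed.

Lemma parts_iter_Qroot b p u :
  parts b (iter p (blockmx_act (Qroot R q)) u) = iter p (@root_act R q) (parts b u).
Proof.
elim: p => //= p <-; apply/funext => j; apply/funext => n.
by rewrite /parts part_Qroot//; exact: partZ.
Qed.

End assembly.

Unset Implicit Arguments.

Theorem corollary7p4 (R : realType) (p q : nat) (hp : (1 <= p)%N)
    (hq : (1 <= q)%N) :
  block_banded (Qfrac R p q) /\
  forall u : 'I_q -> nat -> R[i], in_Pq u ->
    in_Pq (blockmx_act (Qfrac R p q) u) /\
    forall x : R, -1 < x <= 1 ->
      frac_integrable (p%:R / q%:R) (fun t => evalPq t u) x /\
      frac_integral (p%:R / q%:R) (fun t => evalPq t u) x =
      evalPq x (blockmx_act (Qfrac R p q) u).
Proof.
have bQ : block_banded (Qroot R q).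
  by apply/block_bandedP; exists 2%N; exact: block_band_Qroot.
split; first exact: block_banded_exp.
move=> u hu; rewrite /Qfrac blockmx_act_exp//.
have hw : in_Pq (iter p (blockmx_act (Qroot R q)) u).
  apply/in_PqP => b; rewrite parts_iter_Qroot//; apply: real_in_Pq_iter => //.
  exact: (in_PqP u).1.
split => // x x1.
have nu0 : 0 < p%:R / q%:R :> R by rewrite divr_gt0 ?ltr0n.
split.
  apply: cintegrable_parts => b.
  exact: (Rintegral_frac_integrand b nu0 hu x1).1.
apply: part_inj => b; rewrite partZ part_cintegral.
rewrite (Rintegral_frac_integrand b nu0 hu x1).2 mulKf; last first.
  by rewrite gt_eqF// Gamma_gt0.
rewrite part_evalPq_frac// parts_iter_Qroot//; apply: frac_series_iter => //.
exact: (in_PqP u).1.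
Qed.
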